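(* The matrix representation of the Laplacian $\Delta=\partial_x^2+\partial_y^2$, defined by $\Delta\,\mathbf W^{(1,1,1,1)}=\mathbf H^{(1,1,1,1)}\Delta_{W,(1,1,1,1)}^{(1,1,1,1)}$, is $$\Delta_{W,(1,1,1,1)}^{(1,1,1,1)}=D_x^{(0,0,0,0)}W_x^{(1,1,1,1)}+T_{(0,0,1,1)}^{(1,1,1,1)}\,D_y^{(0,0,0,0)}\,T_{W,(1,1,0,0)}^{(0,0,0,0)}\,W_y^{(1,1,1,1)};$$ it has block-bandwidths $(2\deg\rho^2-2,2\deg\rho^2-2)$ and each block has bandwidths $(2,2)$. The matrix representation of the biharmonic operator, defined by $\Delta^2\,\mathbf W^{(2,2,2,2)}=\mathbf H^{(2,2,2,2)}\,{}_2\Delta_{W,(2,2,2,2)}^{(2,2,2,2)}$, is $${}_2\Delta_{W,(2,2,2,2)}^{(2,2,2,2)}=\Delta_{(0,0,0,0)}^{(2,2,2,2)}\,\Delta_{W,(2,2,2,2)}^{(0,0,0,0)},$$ where $$\Delta_{W,(2,2,2,2)}^{(0,0,0,0)}=W_x^{(1,1,1,1)}W_x^{(2,2,2,2)}+T_{W,(1,1,0,0)}^{(0,0,0,0)}\,W_y^{(1,1,1,1)}\,T_{W,(2,2,1,1)}^{(1,1,1,1)}\,W_y^{(2,2,2,2)},$$ $$\Delta_{(0,0,0,0)}^{(2,2,2,2)}=D_x^{(1,1,1,1)}D_x^{(0,0,0,0)}+T_{(1,1,2,2)}^{(2,2,2,2)}\,D_y^{(1,1,1,1)}\,T_{(0,0,1,1)}^{(1,1,1,1)}\,D_y^{(0,0,0,0)},$$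 and ${}_2\Delta_{W,(2,2,2,2)}^{(2,2,2,2)}$ has block-bandwidths $(4\deg\rho^2-4,4\deg\rho^2-4)$ with each block having bandwidths $(4,4)$.
   Context: Setting. Let $\alpha<\beta$ and $\gamma<\delta$ be real, and let $\rho$ be a function on $[\alpha,\beta]$, positive on $(\alpha,\beta)$, with either: case (i), $\rho$ is a polynomial of degree $d_0$ (so $\deg\rho^2=2d_0$); or case (ii), $\rho$ is the square root of a polynomial of degree $d_1=\deg\rho^2$ and $\delta=-\gamma>0$. Put $\eta=0$ in case (i), $\eta=1$ in case (ii), so $d_\eta=\deg\rho^{1+\eta}$; assume $d_\eta\ge 2+\eta$. Let $\Omega=\{(x,y):\alpha\le x\le\beta,\ \gamma\rho(x)\le y\le\delta\rho(x)\}$. Polynomials (parameters $a,b,c,d>-1$, with $c=d$ in case (ii)). $w_R^{(a,b,s)}(x)=(\beta-x)^a(x-\alpha)^b\rho(x)^s$ on $[\alpha,\beta]$, and $R_n^{(a,b,s)}$ ($n\ge0$) are the orthonormal polynomials (degree $n$, positive leading coefficient) for this weight. $w_P^{(d,c)}(y)=(\delta-y)^d(y-\gamma)^c$ on $[\gamma,\delta]$, with orthonormal polynomials $\widetilde P_n^{(d,c)}$. The generalised Koornwinder polynomials are $$H_{n,k}^{(a,b,c,d)}(x,y)=R_{n-k}^{(a,b,c+d+2k+1)}(x)\,\rho(x)^k\,\widetilde P_k^{(d,c)}(y/\rho(x)),\quad 0\le k\le n,$$ orthonormal on $\Omega$ with respect to $W^{(a,b,c,d)}(x,y)=(\beta-x)^a(x-\alpha)^b(y-\gamma\rho(x))^c(\delta\rho(x)-y)^d$.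 $\mathbf H^{(a,b,c,d)}$ is the infinite row vector of all $H_{n,k}^{(a,b,c,d)}$, ordered in blocks $n=0,1,2,\dots$, block $n$ being $(H_{n,0},\dots,H_{n,n})$, and $\mathbf W^{(a,b,c,d)}=W^{(a,b,c,d)}\mathbf H^{(a,b,c,d)}$. Matrices. These are defined by $$\partial_x\mathbf H^{(a,b,c,d)}=\mathbf H^{(a+1,b+1,c+1,d+1)}D_x^{(a,b,c,d)},\quad \partial_y\mathbf H^{(a,b,c,d)}=\mathbf H^{(a,b,c+1,d+1)}D_y^{(a,b,c,d)},$$ $$\partial_x\mathbf W^{(a,b,c,d)}=\mathbf W^{(a-1,b-1,c-1,d-1)}W_x^{(a,b,c,d)},\quad \partial_y\mathbf W^{(a,b,c,d)}=\mathbf W^{(a,b,c-1,d-1)}W_y^{(a,b,c,d)},$$ $$\mathbf H^{(a,b,c,d)}=\mathbf H^{(a+1,b+1,c,d)}T_{(a,b,c,d)}^{(a+1,b+1,c,d)},\quad \mathbf W^{(a,b,c,d)}=\mathbf W^{(a-1,b-1,c,d)}T_{W,(a,b,c,d)}^{(a-1,b-1,c,d)}.$$ Conventions. $A_{[i,j]}$ is the entry in row $i+1$, column $j+1$ of $A$. A matrix has bandwidths $(\sigma,\mu)$ if $A_{[i,j]}=0$ whenever $i-j>\sigma$ or $j-i>\mu$; block-bandwidths are defined in the same way, with block $(i,j)$ (of size $(i+1)\times(j+1)$) in place of entry $[i,j]$, and ''each block has bandwidths'' refers to bandwidths within the blocks. *)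

(* Defs.v *)
From HB Require Import structures.
From mathcomp Require Import all_boot all_order all_algebra.
From mathcomp Require Import all_classical all_reals all_analysis.

Set Implicit Arguments.
Unset Strict Implicit.
Unset Printing Implicit Defensive.

Import Order.TTheory GRing.Theory Num.Theory.
Import numFieldNormedType.Exports.

Local Open Scope classical_set_scope.
Local Open Scope ring_scope.

Section BlockMatrices.
Context {R : realType}.

(* Infinite matrices made of blocks (i, j) of size (i+1) x (j+1). *)
Definition bmx := forall i j : nat, 'M[R]_(i.+1, j.+1).

(* The product is meant for a column-finite B: the sum over l : nat then has
   finite support in every block.  (The sum over a set is 0 if the support is
   infinite.) *)
Definition bmx_mul (A B : bmx) : bmx :=
  fun i j => \sum_(l \in [set: nat]) (A i l *m B l j).

Definition bmx_add (A B : bmx) : bmx := fun i j => A i j + B i j.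

Definition column_finite (A : bmx) :=
  forall j, exists N, forall i, (N <= i)%N -> A i j = 0.

Definition block_banded (sigma mu : nat) (A : bmx) :=
  forall i j, (j + sigma < i)%N \/ (i + mu < j)%N -> A i j = 0.

Definition banded m n (sigma mu : nat) (A : 'M[R]_(m, n)) :=
  forall (k : 'I_m) (l : 'I_n),
    (l + sigma < k)%N \/ (k + mu < l)%N -> A k l = 0.

Definition banded_blocks (sigma mu : nat) (A : bmx) :=
  forall i j, banded sigma mu (A i j).

(* Infinite row vectors of functions of (x, y); block n has n+1 entries. *)
Definition frow := forall n : nat, 'I_n.+1 -> R -> R -> R.

Definition frow_map (op : (R -> R -> R) -> (R -> R -> R)) (F : frow) : frow :=
  fun n k => op (F n k).

(* F = G M on the set D, every entry of G M being a finite sum. *)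
Definition represents (D : set (R * R)) (F G : frow) (M : bmx) :=
  column_finite M /\
  forall n (k : 'I_n.+1) x y, D (x, y) ->
    F n k x y =
    \sum_(m \in [set: nat]) \sum_(j < m.+1) G m j x y * M m n j k.

(* "The" matrix M such that F = G M on D (the zero matrix if there is none). *)
Definition matrix_of (D : set (R * R)) (F G : frow) : bmx :=
  xget (fun _ _ => 0) [set M : bmx | represents D F G M].

(* L is the one and only matrix such that F = G L on D. *)
Definition is_matrix_of (D : set (R * R)) (F G : frow) (L : bmx) :=
  forall M : bmx, represents D F G M <-> M = L.

Definition partial_x (f : R -> R -> R) : R -> R -> R :=
  fun x y => derive1 (fun t => f t y) x.

Definition partial_y (f : R -> R -> R) : R -> R -> R :=
  fun x y => derive1 (f x) y.

Definition laplacian (f : R -> R -> R) : R -> R -> R :=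
  fun x y => partial_x (partial_x f) x y + partial_y (partial_y f) x y.

Definition biharmonic (f : R -> R -> R) : R -> R -> R :=
  laplacian (laplacian f).

End BlockMatrices.

Arguments bmx : clear implicits.
Arguments frow : clear implicits.

Notation "A *b B" := (bmx_mul A B) (at level 40, left associativity).
Notation "A +b B" := (bmx_add A B) (at level 50, left associativity).

Section OrthonormalPolynomials.
Context {R : realType}.

Definition orthonormal_polys (l u : R) (w : R -> R) (p : nat -> {poly R}) :=
  (forall n, size (p n) = n.+1 /\ 0 < lead_coef (p n)) /\
  (forall m n, \int[lebesgue_measure]_(x in `[l, u])
     (w x * (p m).[x] * (p n).[x]) = (m == n)%:R).

(* "The" orthonormal polynomials on [l, u] for the weight w; for a weight,
   the conditions have at most one solution. *)
Definition orthopoly (l u : R) (w : R -> R) : nat -> {poly R} :=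
  xget (fun=> 0) [set p | orthonormal_polys l u w p].

End OrthonormalPolynomials.

Section Koornwinder.
Context {R : realType} (al be ga de : R) (rho : R -> R).

(* Case (i) is eta = false, case (ii) is eta = true; q is the polynomial
   rho ^ (1 + eta), so (size q).-1 is d_eta. *)
Definition rho_case (eta : bool) (q : {poly R}) :=
  (forall x, al <= x <= be -> rho x = if eta then Num.sqrt q.[x] else q.[x]) /\
  (eta -> de = - ga /\ 0 < de).

Definition deg_rho_sqr (eta : bool) (q : {poly R}) : nat :=
  (size (if eta then q else q ^+ 2)).-1.

Definition Omega : set (R * R) :=
  [set z | al <= z.1 <= be /\ ga * rho z.1 <= z.2 <= de * rho z.1].

Definition wR (a b s x : R) : R :=
  (be - x) `^ a * (x - al) `^ b * rho x `^ s.

Definition Rpoly (a b s : R) : nat -> {poly R} := orthopoly al be (wR a b s).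

Definition wP (d c y : R) : R := (de - y) `^ d * (y - ga) `^ c.

Definition Ppoly (d c : R) : nat -> {poly R} := orthopoly ga de (wP d c).

Definition H (a b c d : R) : frow R := fun n k x y =>
  (Rpoly a b (c + d + (2 * k + 1)%:R) (n - k)).[x]
  * rho x ^+ k * (Ppoly d c k).[y / rho x].

Definition weight (a b c d x y : R) : R :=
  (be - x) `^ a * (x - al) `^ b
  * (y - ga * rho x) `^ c * (de * rho x - y) `^ d.

Definition W (a b c d : R) : frow R := fun n k x y =>
  weight a b c d x y * H a b c d k x y.

(* The defining identities are between functions on Omega; they are read on its
   interior, where rho > 0 and the derivatives make sense. *)
Definition Dx (a b c d : R) : bmx R :=
  matrix_of Omega° (frow_map partial_x (H a b c d))
                   (H (a + 1) (b + 1) (c + 1) (d + 1)).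

Definition Dy (a b c d : R) : bmx R :=
  matrix_of Omega° (frow_map partial_y (H a b c d)) (H a b (c + 1) (d + 1)).

Definition Wx (a b c d : R) : bmx R :=
  matrix_of Omega° (frow_map partial_x (W a b c d))
                   (W (a - 1) (b - 1) (c - 1) (d - 1)).

Definition Wy (a b c d : R) : bmx R :=
  matrix_of Omega° (frow_map partial_y (W a b c d)) (W a b (c - 1) (d - 1)).

(* The conversions T_(a,b,c,d)^(a+1,b+1,c,d) and T_{W,(a,b,c,d)}^(a-1,b-1,c,d) *)
Definition T (a b c d : R) : bmx R :=
  matrix_of Omega° (H a b c d) (H (a + 1) (b + 1) c d).

Definition TW (a b c d : R) : bmx R :=
  matrix_of Omega° (W a b c d) (W (a - 1) (b - 1) c d).

End Koornwinder.

(* Main.v *)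
Require Import Defs.
From mathcomp Require Import all_boot all_order all_algebra.
From mathcomp Require Import all_classical all_reals all_analysis.
From mathcomp Require Import measurable_realfun.
From mathcomp Require Import ring lra zify.
Import Order.TTheory GRing.Theory Num.Theory.
Import numFieldNormedType.Exports.
Local Open Scope classical_set_scope.
Local Open Scope ring_scope.

(** Write t = y / rho for the slope. Up to the weight, every function of the two
    families is R_m(x) rho^k P_k(t) with m = n - k, and the x- and y-derivatives
    of p(x) rho^e g(t) are again sums of such products (is_derive_sep_x,
    is_derive_sep_y): writing rho' as (rho^2)' / (2 rho), only the polynomial
    rho^2 and the Euler operator e - t d/dt on g appear. Expanding g and its Euler
    image in the P_k', and then the polynomials in x that multiply rho^k' P_k' in
    the R_m', gives the entries of the six matrices as products of univariate
    integrals. No integral over Omega is used.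

    Differentiation in y sends (m, k) to (m, k - 1), and its weighted form sends
    (m, k) to (m, k + 1); the conversions fix k and move m by at most 2. The heart
    of the proof is differentiation in x. Degrees alone give half of the bands: k
    drops by 0, 1 or 2, and n grows by at most d - 3, where d is the degree of
    rho^2, or by at most d + 1 in the weighted form. A drop by 1 requires rho
    itself to be a polynomial; otherwise it is excluded by parity (coefy_odd).
    The other half comes from orthogonality: integration by parts in x and in t
    shows that the matrix W_x is minus the transpose of D_x (coefx_adjE), so that
    each inherits the bands of the other (coefx_support, coefx_band).

    Uniqueness of all the representing matrices is the linear independence of the
    two families on the interior of Omega (hfun_free), which follows from that of
    the P_k for fixed x and then of the R_m. The compositions then follow formally:
    a representation can be differentiated term by term on an open set
    (represents_partial_x, represents_partial_y), representations compose by the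
    matrix product (represents_mul), and bandwidths add (banded_bmx_mul). The
    extreme bands of the Laplacian are those of D_x W_x, namely
    (d - 3) + (d + 1) = 2 d - 2 on both sides, and those of the biharmonic operator
    are twice as large. *)

Set Implicit Arguments.
Unset Strict Implicit.
Unset Printing Implicit Defensive.

(** * Infinite block matrices and the representation of row vectors *)

Section BlockMatrixAlgebra.
Variable R : realType.
Implicit Types (A B M : bmx R) (F G K : frow R) (D : set (R * R)).

Lemma fsbig_nat_trunc (V : nmodType) (f : nat -> V) N :
  (forall i, (N <= i)%N -> f i = 0) ->
  \sum_(i \in [set: nat]) f i = \sum_(i < N) f i.
Proof.
move=> f0; rewrite fsbig_ord -(@fsbig_widen _ _ _ _ `I_N)//.
by move=> i /= [_ /negP]; rewrite -leqNgt => /f0.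
Qed.

Lemma bmx_mulE A B i j N : (forall l, (N <= l)%N -> B l j = 0) ->
  (A *b B) i j = \sum_(l < N) A i l *m B l j.
Proof.
by move=> B0; apply: fsbig_nat_trunc => l /B0 ->; rewrite mulmx0.
Qed.

Lemma column_finite_upto A N : column_finite A ->
  exists P, forall m, (m < N)%N -> forall i, (P <= i)%N -> A i m = 0.
Proof.
move=> cA; elim: N => [|n [P IH]]; first by exists 0%N.
have [Q AQ] := cA n; exists (maxn P Q) => m; rewrite ltnS leq_eqVlt.
move=> /predU1P[->|mn] i; rewrite geq_max => /andP[Pi Qi]; first exact: AQ.
exact: IH.
Qed.

Lemma column_finite_mul A B :
  column_finite A -> column_finite B -> column_finite (A *b B).
Proof.
move=> cA cB j; have [N BN] := cB j; have [P AP] := column_finite_upto N cA.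
exists P => i Pi; rewrite (bmx_mulE _ _ BN).
by rewrite big1 // => l _; rewrite AP ?mul0mx.
Qed.

Lemma representsE D F G M n (k : 'I_n.+1) x y N : represents D F G M ->
  D (x, y) -> (forall i, (N <= i)%N -> M i n = 0) ->
  F n k x y = \sum_(m < N) \sum_(j < m.+1) G m j x y * M m n j k.
Proof.
move=> [_ FGM] Dxy MN; rewrite FGM//; apply: fsbig_nat_trunc => i /MN Mi.
by rewrite big1 // => j _; rewrite Mi mxE mulr0.
Qed.

Lemma represents_trunc D F G M :
  (forall n, exists2 N, forall i, (N <= i)%N -> M i n = 0 &
    forall (k : 'I_n.+1) x y, D (x, y) ->
      F n k x y = \sum_(m < N) \sum_(j < m.+1) G m j x y * M m n j k) ->
  represents D F G M.
Proof.
move=> FGM; split=> [n|n k x y Dxy].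
  by have [N MN _] := FGM n; exists N.
have [N MN ->//] := FGM n; apply/esym/fsbig_nat_trunc => i /MN Mi.
by rewrite big1 // => j _; rewrite Mi mxE mulr0.
Qed.

(** A column of M meets finitely many columns of N, so the two sums can be
    truncated together and interchanged. *)
Lemma represents_mul D F G K M N :
  represents D F G M -> represents D G K N -> represents D F K (N *b M).
Proof.
move=> FM GN; have [cM _] := FM; have [cN _] := GN.
split; first exact: column_finite_mul.
move=> n k x y Dxy; have [P MP] := cM n.
have [Q NQ] := column_finite_upto P cN.
rewrite (representsE k FM Dxy MP) (@fsbig_nat_trunc _ _ Q); last first.
  move=> i Qi; rewrite big1 // => j _; rewrite (bmx_mulE _ _ MP) summxE.
  by rewrite big1 ?mulr0 // => l _; rewrite NQ // mul0mx mxE.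
under eq_bigr => m _.
  under eq_bigr => j _.
    rewrite (representsE j GN Dxy (NQ m (ltn_ord m))) big_distrl /=.
    under eq_bigr => p _ do rewrite big_distrl /=.
  over.
  rewrite exchange_big /=.
over.
rewrite exchange_big /=; apply: eq_bigr => p _.
under eq_bigr => m _ do rewrite exchange_big /=.
rewrite exchange_big /=; apply: eq_bigr => i _.
rewrite (bmx_mulE _ _ MP) summxE big_distrr /=; apply: eq_bigr => m _.
by rewrite mxE big_distrr /=; apply: eq_bigr => j _; rewrite mulrA.
Qed.

Lemma represents_add D F1 F2 G M1 M2 :
  represents D F1 G M1 -> represents D F2 G M2 ->
  represents D (fun n k x y => F1 n k x y + F2 n k x y) G (M1 +b M2).
Proof.
move=> FM1 FM2; have [c1 _] := FM1; have [c2 _] := FM2.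
apply: represents_trunc => n; have [N1 MN1] := c1 n; have [N2 MN2] := c2 n.
have MN1' i : (maxn N1 N2 <= i)%N -> M1 i n = 0.
  by rewrite geq_max => /andP[/MN1].
have MN2' i : (maxn N1 N2 <= i)%N -> M2 i n = 0.
  by rewrite geq_max => /andP[_ /MN2].
exists (maxn N1 N2) => [i Ni|k x y Dxy].
  by rewrite /bmx_add MN1' // MN2' // addr0.
rewrite (representsE k FM1 Dxy MN1') (representsE k FM2 Dxy MN2') -big_split /=.
apply: eq_bigr => m _; rewrite -big_split /=; apply: eq_bigr => j _.
by rewrite mxE mulrDr.
Qed.

(** Tested on D only, since representations are identities on D; it is what
    makes a representing matrix unique. *)
Definition independent D G := forall (c : forall n, 'I_n.+1 -> R) N,
  (forall x y, D (x, y) -> \sum_(m < N) \sum_(j < m.+1) G m j x y * c m j = 0) ->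
  forall m, (m < N)%N -> forall j, c m j = 0.

Lemma represents_uniq D F G M N : independent D G ->
  represents D F G M -> represents D F G N -> M = N.
Proof.
move=> iG FM FN; have [cM _] := FM; have [cN _] := FN.
apply: functional_extensionality_dep => m.
apply: functional_extensionality_dep => n.
apply/matrixP => j k; have [P MP] := cM n; have [Q NQ] := cN n.
pose S := maxn m.+1 (maxn P Q).
have MS i : (S <= i)%N -> M i n = 0 by rewrite !geq_max => /and3P[_ /MP].
have NS i : (S <= i)%N -> N i n = 0 by rewrite !geq_max => /and3P[_ _ /NQ].
apply/eqP; rewrite -subr_eq0; apply/eqP.
apply: (iG (fun m j => M m n j k - N m n j k) S) => [x y Dxy|]; last first.
  by rewrite leq_max leqnn.
under eq_bigr => i _ do
  (under eq_bigr => l _ do rewrite mulrBr; rewrite big_split /= sumrN).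
by rewrite big_split /= sumrN -(representsE k FM Dxy MS)
  -(representsE k FN Dxy NS) subrr.
Qed.

Lemma is_matrix_of_represents D F G L : independent D G ->
  represents D F G L -> is_matrix_of D F G L.
Proof.
by move=> iG FL M; split=> [FM|->//]; exact: represents_uniq FM FL.
Qed.

Lemma matrix_of_represents D F G M : independent D G ->
  represents D F G M -> matrix_of D F G = M.
Proof.
move=> iG FM; apply: (represents_uniq iG _ FM).
by apply: (@xgetPex _ _ [set M | represents D F G M]); exists M.
Qed.

(** The first two numbers are the lower and upper bandwidths of the array of
    blocks, the last two those inside the blocks. *)
Definition banded_bmx s m s' m' A := block_banded s m A /\ banded_blocks s' m' A.

Lemma banded_bmx_mul s m s' m' t n t' n' A B :
  banded_bmx s m s' m' A -> banded_bmx t n t' n' B ->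
  banded_bmx (s + t) (m + n) (s' + t') (m' + n') (A *b B).
Proof.
move=> [bA cA] [bB cB]; split=> i j.
  move=> ij; apply: fsbig1 => l _.
  have [|->] : A i l = 0 \/ B l j = 0; [|by move=> ->; rewrite mul0mx|by rewrite mulmx0].
  have [il|il] := boolP ((l + s < i) || (i + m < l))%N.
    by left; apply: bA; apply/orP.
  by right; apply: bB; lia.
move=> k l kl; rewrite (@bmx_mulE _ _ _ _ (j + t).+1); last first.
  by move=> p jp; apply: bB; left.
rewrite summxE big1 // => p _; rewrite mxE big1 // => u _.
have [ku|ku] := boolP ((u + s' < k) || (k + m' < u))%N.
  by rewrite cA ?mul0r //; apply/orP.
by rewrite cB ?mulr0 //; lia.
Qed.

Lemma banded_bmx_add s m s' m' A B :
  banded_bmx s m s' m' A -> banded_bmx s m s' m' B ->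
  banded_bmx s m s' m' (A +b B).
Proof.
move=> [bA cA] [bB cB]; split=> i j.
  by move=> ij; rewrite /bmx_add bA // bB // addr0.
by move=> k l kl; rewrite mxE cA // cB // addr0.
Qed.

Lemma banded_bmx_widen s m s' m' t n t' n' A :
  (s <= t)%N -> (m <= n)%N -> (s' <= t')%N -> (m' <= n')%N ->
  banded_bmx s m s' m' A -> banded_bmx t n t' n' A.
Proof.
move=> st mn st' mn' [bA cA]; split=> i j.
  by move=> ij; apply: bA; lia.
by move=> k l kl; apply: cA; lia.
Qed.

End BlockMatrixAlgebra.

(** * Differentiating a representation *)

Section DifferentiateRepresentation.
Variable R : realType.
Implicit Types (M : bmx R) (F G K : frow R) (D : set (R * R)).

Definition derivable_x D F := forall n (k : 'I_n.+1) x y, D (x, y) ->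
  derivable (fun t => F n k t y) x 1.

Definition derivable_y D F := forall n (k : 'I_n.+1) x y, D (x, y) ->
  derivable (F n k x) y 1.

Lemma is_derive_linear_comb (f : R -> R) N (g : forall m, 'I_m.+1 -> R -> R)
    (c : forall m, 'I_m.+1 -> R) (x : R) :
  (\near x, f x = \sum_(m < N) \sum_(j < m.+1) g m j x * c m j) ->
  (forall m (j : 'I_m.+1), derivable (g m j) x 1) ->
  is_derive x 1 f (\sum_(m < N) \sum_(j < m.+1) derive1 (g m j) x * c m j).
Proof.
move=> fE dg; pose h (m : 'I_N) := \sum_(j < m.+1) (c m j *: g m j).
have fE' : \near x, (\sum_(m < N) h m) x = f x.
  near=> t; have -> : f t = \sum_(m < N) \sum_(j < m.+1) g m j t * c m j by near: t.
  rewrite fct_sumE; apply: eq_bigr => m _; rewrite /h fct_sumE.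
  by apply: eq_bigr => j _ /=; rewrite mulrC.
apply: (near_eq_is_derive fE'); apply: is_derive_sum => m; rewrite /h.
apply: is_derive_sum => j; rewrite mulrC derive1E.
by apply: is_deriveZ; exact/derivableP.
Unshelve. all: by end_near. Qed.

Lemma open_near_x D x y : open D -> D (x, y) -> \near x, D (x, y).
Proof.
move=> oD Dxy; have : nbhs (x, y) D by apply: open_nbhs_nbhs.
by move=> [[A B] /= [Ax By] AB]; near=> t; apply: AB; split => /=;
  [near: t | exact: nbhs_singleton].
Unshelve. all: by end_near. Qed.

Lemma open_near_y D x y : open D -> D (x, y) -> \near y, D (x, y).
Proof.
move=> oD Dxy; have : nbhs (x, y) D by apply: open_nbhs_nbhs.
by move=> [[A B] /= [Ax By] AB]; near=> t; apply: AB; split => /=;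
  [exact: nbhs_singleton | near: t].
Unshelve. all: by end_near. Qed.

(** Near a point of the open set D an entry of F is one and the same finite
    combination of entries of G, so it can be differentiated term by term. *)
Lemma represents_partial_x D F G M : open D -> represents D F G M ->
  derivable_x D G -> derivable_x D F /\
  represents D (frow_map partial_x F) (frow_map partial_x G) M.
Proof.
move=> oD FM dG; have [cM _] := FM.
have dF N n (k : 'I_n.+1) x y : D (x, y) -> (forall i, (N <= i)%N -> M i n = 0) ->
    is_derive x 1 (fun t => F n k t y)
     (\sum_(m < N) \sum_(j < m.+1) partial_x (G m j) x y * M m n j k).
  move=> Dxy MN; apply: (@is_derive_linear_comb _ N (fun m j t => G m j t y)
    (fun m j => M m n j k)); last by move=> m j; exact: dG.
  have := open_near_x oD Dxy; apply: filterS => t Dt.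
  exact: (representsE k FM).
split=> [n k x y Dxy|].
  by have [N MN] := cM n; have [] := dF N n k x y Dxy MN.
apply: represents_trunc => n; have [N MN] := cM n; exists N => // k x y Dxy.
by rewrite /frow_map {1}/partial_x derive1E; have [_ ->] := dF N n k x y Dxy MN.
Qed.

Lemma represents_partial_y D F G M : open D -> represents D F G M ->
  derivable_y D G -> derivable_y D F /\
  represents D (frow_map partial_y F) (frow_map partial_y G) M.
Proof.
move=> oD FM dG; have [cM _] := FM.
have dF N n (k : 'I_n.+1) x y : D (x, y) -> (forall i, (N <= i)%N -> M i n = 0) ->
    is_derive y 1 (F n k x)
     (\sum_(m < N) \sum_(j < m.+1) partial_y (G m j) x y * M m n j k).
  move=> Dxy MN; apply: (@is_derive_linear_comb _ N (fun m j t => G m j x t)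
    (fun m j => M m n j k)); last by move=> m j; exact: dG.
  have := open_near_y oD Dxy; apply: filterS => t Dt.
  exact: (representsE k FM).
split=> [n k x y Dxy|].
  by have [N MN] := cM n; have [] := dF N n k x y Dxy MN.
apply: represents_trunc => n; have [N MN] := cM n; exists N => // k x y Dxy.
by rewrite /frow_map {1}/partial_y derive1E; have [_ ->] := dF N n k x y Dxy MN.
Qed.

Lemma represents_laplacian D F G M : open D -> represents D F G M ->
  derivable_x D G -> derivable_x D (frow_map partial_x G) ->
  derivable_y D G -> derivable_y D (frow_map partial_y G) ->
  represents D (frow_map laplacian F) (frow_map laplacian G) M.
Proof.
move=> oD FM dxG dxxG dyG dyyG.
have [_ FxM] := represents_partial_x oD FM dxG.
have [_ [cM Fxx]] := represents_partial_x oD FxM dxxG.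
have [_ FyM] := represents_partial_y oD FM dyG.
have [_ Fyy] := represents_partial_y oD FyM dyyG.
apply: represents_trunc => n; have [N MN] := cM n; exists N => // k x y Dxy.
rewrite /frow_map /laplacian; have := representsE k (conj cM Fxx) Dxy MN.
rewrite /frow_map => ->; have := representsE k Fyy Dxy MN.
rewrite /frow_map => ->; rewrite -big_split /=; apply: eq_bigr => m _.
by rewrite -big_split /=; apply: eq_bigr => j _; rewrite mulrDl.
Qed.

End DifferentiateRepresentation.

(** * Orthonormal polynomials of a linear functional *)

Section OrthonormalFunctional.
Variable R : realType.
Implicit Types (l : {poly R} -> R) (p : nat -> {poly R}) (u v : {poly R}).

Definition functional l := forall c u v, l (c *: u + v) = c * l u + l v.

Definition orthonormal_for l p :=
  (forall n, size (p n) = n.+1 /\ 0 < lead_coef (p n)) /\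
  (forall m n, l (p m * p n) = (m == n)%:R).

Section Functional.
Variables (l : {poly R} -> R) (lin : functional l).

Lemma functional0 : l 0 = 0.
Proof. by have := lin 1 0 0; rewrite scaler0 addr0 mul1r; lra. Qed.

Lemma functionalD u v : l (u + v) = l u + l v.
Proof. by rewrite -[u]scale1r lin mul1r scale1r. Qed.

Lemma functionalZ c u : l (c *: u) = c * l u.
Proof. by rewrite -[c *: u]addr0 lin functional0 addr0. Qed.

Lemma functionalN u : l (- u) = - l u.
Proof. by rewrite -scaleN1r functionalZ mulN1r. Qed.

Lemma functionalB u v : l (u - v) = l u - l v.
Proof. by rewrite functionalD functionalN. Qed.

Lemma functional_sum I (r : seq I) (P : pred I) (f : I -> {poly R}) :
  l (\sum_(i <- r | P i) f i) = \sum_(i <- r | P i) l (f i).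
Proof. by apply: big_morph; [exact: functionalD|exact: functional0]. Qed.

End Functional.

Section Expansion.
Variables (l : {poly R} -> R) (lin : functional l) (p : nat -> {poly R}).

(** Leading terms are eliminated from the top degree down. *)
Lemma degree_basis (sp : forall n, size (p n) = n.+1) N u : (size u <= N)%N ->
  exists c : nat -> R, u = \sum_(i < N) c i *: p i.
Proof.
elim: N u => [|N IH] u uN.
  by exists (fun=> 0); rewrite big_ord0; apply/eqP; rewrite -size_poly_leq0.
have pN0 : (p N)`_N != 0.
  by have := sp N; rewrite -[X in _`_X]/(N.+1.-1) => <-;
    rewrite -lead_coefE lead_coef_eq0 -size_poly_gt0 sp.
pose a := u`_N / (p N)`_N.
have [|c uc] := IH (u - a *: p N).
  apply/leq_sizeP => j; rewrite leq_eqVlt => /predU1P[<-|Nj].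
    by rewrite coefB coefZ /a divfK // subrr.
  rewrite coefB coefZ !nth_default ?mulr0 ?subrr // ?sp //.
  exact: leq_trans uN Nj.
exists (fun i => if i == N then a else c i); rewrite big_ord_recr /= eqxx.
rewrite -(subrK (a *: p N) u) uc; congr (_ + _); apply: eq_bigr => i _.
by rewrite ltn_eqF.
Qed.

Hypothesis op : orthonormal_for l p.

Lemma orthonormal_expansion N u : (size u <= N)%N ->
  u = \sum_(i < N) l (u * p i) *: p i.
Proof.
have [sp lp] := op.
move=> /(degree_basis (fun n => (sp n).1)) [c uc]; rewrite {1}uc.
apply: eq_bigr => i _; congr (_ *: _); rewrite uc mulr_suml functional_sum //.
rewrite (bigD1 i) //= -scalerAl functionalZ // lp eqxx mulr1 big1 ?addr0 //.
move=> j ji; rewrite -scalerAl functionalZ // lp.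
by rewrite -val_eqE /= in ji; rewrite (negPf ji) mulr0.
Qed.

Lemma orthonormal_low n u : (size u <= n)%N -> l (u * p n) = 0.
Proof.
have [sp lp] := op.
move=> /orthonormal_expansion ->; rewrite mulr_suml functional_sum // big1 // => i _.
by rewrite -scalerAl functionalZ // lp (ltn_eqF (ltn_ord i)) mulr0.
Qed.

Lemma orthonormal_low_l n u : (size u <= n)%N -> l (p n * u) = 0.
Proof. by rewrite mulrC; exact: orthonormal_low. Qed.

Lemma orthonormal_free N (c : nat -> R) :
  \sum_(i < N) c i *: p i = 0 -> forall i, (i < N)%N -> c i = 0.
Proof.
have [_ lp] := op.
move=> c0 i iN; have := congr1 (fun u => l (u * p i)) c0.
rewrite mul0r (functional0 lin) mulr_suml functional_sum //.
rewrite (bigD1 (Ordinal iN)) //= -scalerAl functionalZ // lp eqxx mulr1.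
rewrite big1 ?addr0 // => j ji; rewrite -scalerAl functionalZ // lp.
by rewrite -val_eqE /= in ji; rewrite (negPf ji) mulr0.
Qed.

(** The reflected polynomial is still orthogonal to all lower degrees, and up to
    the sign it has the same leading term. *)
Lemma orthonormal_parity : (forall u, l (u \Po - 'X) = l u) ->
  forall n, p n \Po - 'X = (-1) ^+ n *: p n.
Proof.
move=> lN n; have [sp lp] := op.
have sN u : size (u \Po - 'X) = size u.
  by rewrite size_comp_poly2 // size_polyN size_polyX.
have cN u i : (u \Po - 'X)`_i = (-1) ^+ i * u`_i.
  rewrite comp_polyE coef_sum; under eq_bigr => j _.
    rewrite -['X]scale1r -scaleNr exprZn coefZ coefZ coefXn; over.
  have [iu|iu] := ltnP i (size u).
    rewrite (bigD1 (Ordinal iu)) //= eqxx big1 => [|j ji].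
      by rewrite addr0 mulr1 mulrC.
    by rewrite -val_eqE eq_sym /= in ji; rewrite (negPf ji) !mulr0.
  rewrite nth_default // mulr0 big1 // => j _.
  by rewrite gtn_eqF ?mulr0 // (leq_trans _ iu).
pose v := p n \Po - 'X - (-1) ^+ n *: p n.
have sv : (size v <= n)%N.
  apply/leq_sizeP => j; rewrite leq_eqVlt => /predU1P[<-|nj].
    by rewrite coefB coefZ cN subrr.
  by rewrite coefB coefZ !nth_default ?mulr0 ?subr0 // ?sN (sp n).1.
apply/eqP; rewrite -subr_eq0 -/v; apply/eqP.
rewrite [v](orthonormal_expansion sv) big1 // => i _.
rewrite /v mulrBl functionalB // -scalerAl functionalZ // lp.
rewrite gtn_eqF // mulr0 subr0.
have -> : (p n \Po - 'X) * p i = (p n * (p i \Po - 'X)) \Po - 'X.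
  by rewrite comp_polyM -comp_polyA raddfN /= comp_polyX opprK comp_polyXr.
by rewrite lN orthonormal_low_l ?scale0r // sN (sp i).1.
Qed.

End Expansion.

Section GramSchmidt.
Variables (l : {poly R} -> R) (lin : functional l).
Hypothesis pos : forall u, u != 0 -> 0 < l (u * u).

Definition gram_schmidt_step n (s : seq {poly R}) : {poly R} :=
  let v := 'X^n - \sum_(u <- s) l ('X^n * u) *: u in
  (Num.sqrt (l (v * v)))^-1 *: v.

(** All the earlier polynomials are carried along, because each step of the
    Gram-Schmidt process needs all of them. *)
Fixpoint gram_schmidt_seq n : seq {poly R} :=
  if n is m.+1 then rcons (gram_schmidt_seq m)
                          (gram_schmidt_step m (gram_schmidt_seq m))
  else [::].

Definition gram_schmidt n := gram_schmidt_step n (gram_schmidt_seq n).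

Lemma gram_schmidt_seqE n :
  gram_schmidt_seq n = [seq gram_schmidt i | i <- iota 0 n].
Proof.
elim: n => // n IH.
by rewrite -[in RHS]addn1 iotaD map_cat -IH /= add0n cats1.
Qed.

Lemma gram_schmidt_orthonormal : orthonormal_for l gram_schmidt.
Proof.
suff H n : (size (gram_schmidt n) = n.+1 /\ 0 < lead_coef (gram_schmidt n)) /\
    forall m, (m <= n)%N -> l (gram_schmidt m * gram_schmidt n) = (m == n)%:R.
  split=> [n|m n]; first by have [] := H n.
  have [mn|/ltnW mn] := leqP m n; first by have [_ ->] := H n.
  by have [_ lm] := H m; rewrite mulrC lm // eq_sym.
elim/ltn_ind: n => n IH.
pose v : {poly R} := 'X^n - \sum_(i < n) l ('X^n * gram_schmidt i) *: gram_schmidt i.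
have vE : v = 'X^n - \sum_(i <- iota 0 n) l ('X^n * gram_schmidt i) *: gram_schmidt i.
  by rewrite -[n in iota _ n]subn0 -/(index_iota 0 n) big_mkord.
have gE : gram_schmidt n = (Num.sqrt (l (v * v)))^-1 *: v.
  by rewrite /gram_schmidt /gram_schmidt_step gram_schmidt_seqE big_map -vE.
have sS : (size (\sum_(i < n) l ('X^n * gram_schmidt i) *: gram_schmidt i)%R <= n)%N.
  apply: (leq_trans (size_sum _ _ _)); apply/bigmax_leqP => i _.
  by apply: (leq_trans (size_scale_leq _ _)); have [[-> _] _] := IH i (ltn_ord i).
have sv : size v = n.+1.
  by rewrite /v size_polyDl size_polyXn // size_polyN ltnS.
have lv : lead_coef v = 1.
  by rewrite /v lead_coefDl ?lead_coefXn // size_polyXn size_polyN ltnS.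
have v0 : v != 0 by rewrite -size_poly_gt0 sv.
have s0 : 0 < Num.sqrt (l (v * v)) by rewrite sqrtr_gt0 pos.
split.
  rewrite gE lead_coefZ lv mulr1 invr_gt0 s0 size_scale ?sv //.
  by rewrite invr_eq0 gt_eqF.
move=> m; rewrite leq_eqVlt => /predU1P[->|mn].
  rewrite gE eqxx -scalerAl -scalerAr !functionalZ // mulrA -invfM.
  by rewrite -[X in X^-1]expr2 sqr_sqrtr ?mulVf ?gt_eqF // ?ltW ?pos.
rewrite ltn_eqF // gE -scalerAr functionalZ //; apply/eqP; rewrite mulf_eq0.
apply/orP; right; apply/eqP.
rewrite /v mulrBr functionalB // mulr_sumr functional_sum //.
rewrite (bigD1 (Ordinal mn)) //= -scalerAr functionalZ //.
have -> : l (gram_schmidt m * gram_schmidt m) = 1.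
  by have [_ ->] := IH m mn; rewrite ?eqxx.
rewrite mulr1 big1 ?addr0 => [|i im]; first by rewrite mulrC subrr.
rewrite -val_eqE /= in im.
rewrite -scalerAr functionalZ //.
have [mi|mi] := leqP m i.
  by have [_ ->//] := IH i (ltn_ord i); rewrite eq_sym (negPf im) mulr0.
have [_ lm] := IH m mn.
by rewrite mulrC (mulrC (gram_schmidt m)) lm ?(ltnW mi) // (negPf im) mul0r.
Qed.

End GramSchmidt.

End OrthonormalFunctional.

(** * Integrals of continuous functions over a segment *)

Section SegmentIntegral.
Variable R : realType.
Variables (l u : R).
Hypothesis lu : l < u.
Local Notation mu := (@lebesgue_measure R).
Implicit Types f g F : R -> R.

Lemma continuous_integrable_itv f : continuous f ->
  mu.-integrable `[l, u] (EFin \o f).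
Proof.
move=> cf; apply: continuous_compact_integrable; first exact: segment_compact.
exact: continuous_subspaceT.
Qed.

(** The end points form a null set. *)
Lemma Rintegral_eq_oo f g : {in `]l, u[, f =1 g} -> continuous g ->
  \int[mu]_(x in `[l, u]) f x = \int[mu]_(x in `[l, u]) g x.
Proof.
move=> fg cg; have mg : measurable_fun `]l, u[ g.
  by apply: measurable_funTS; exact: continuous_measurable_fun.
rewrite /Rintegral; congr fine; apply: eq_integral_itv_bounded => //.
by apply: eq_measurable_fun mg => x /set_mem xlu; rewrite fg.
Qed.

Lemma Rintegral_FTC f F : continuous F -> continuous f ->
  (forall x, l < x < u -> is_derive x 1 F (f x)) ->
  \int[mu]_(x in `[l, u]) f x = F u - F l.
Proof.
move=> cF cf dF; rewrite /Rintegral (@continuous_FTC2 _ f F) //.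
- exact: continuous_subspaceT.
- split; last 2 first.
  + by apply: cvg_at_right_filter; exact: cF.
  + by apply: cvg_at_left_filter; exact: cF.
  by move=> x /[!in_itv]/= /dF [].
- by move=> x /[!in_itv]/= /dF [_ <-]; rewrite derive1E.
Qed.

(** On a segment around x0 the function exceeds half its value at x0. *)
Lemma Rintegral_gt0 f x0 : continuous f -> (forall x, l < x < u -> 0 <= f x) ->
  l < x0 < u -> 0 < f x0 -> 0 < \int[mu]_(x in `[l, u]) f x.
Proof.
move=> cf f0 /andP[lx xu] fx0.
(* The absolute value is nonnegative at the end points as well. *)
pose g x := `|f x|.
have cg : continuous g by move=> x; apply: cvg_norm; exact: cf.
rewrite (@Rintegral_eq_oo f g) //; last first.
  by move=> x /[!in_itv]/= /f0 ?; rewrite /g ger0_norm.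
have gx0 : 0 < g x0 by rewrite /g normr_gt0 gt_eqF.
have : \forall x \near x0, g x0 / 2 < g x.
  have gt2 : g x0 / 2 < g x0 by lra.
  exact: (@cvgr_gt _ _ _ _ g _ (cg x0) _ gt2).
move=> /nbhs_ballP[e /= e0 ge].
pose c := Num.max l (x0 - e / 2); pose d := Num.min u (x0 + e / 2).
have cd : c < d.
  by rewrite /c /d gt_max !lt_min; apply/andP; split; apply/andP; split; lra.
have clu : `[c, d] `<=` `[l, u].
  move=> x /=; rewrite !in_itv/= => /andP[].
  by rewrite /c /d ge_max le_min => /andP[-> _] /andP[-> _].
have gcd x : x \in `[c, d] -> g x0 / 2 <= g x.
  rewrite in_itv/= /c /d ge_max le_min => /andP[/andP[_ h1] /andP[_ h2]].
  apply/ltW/ge; rewrite /ball /= ltr_distl; apply/andP; split; lra.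
have mg : measurable_fun setT (EFin \o g).
  by apply/measurable_EFinP; exact: continuous_measurable_fun.
have ig := continuous_integrable_itv cg.
have : (((g x0 / 2) * (d - c))%:E <= \int[mu]_(x in `[l, u]) (g x)%:E)%E.
  apply: (@le_trans _ _ (\int[mu]_(x in `[c, d]) (g x)%:E)%E).
    have -> : ((g x0 / 2 * (d - c))%:E = \int[mu]_(x in `[c, d]) (cst (g x0 / 2)%:E x))%E.
      rewrite integral_cst //= lebesgue_measure_itv /= lte_fin cd.
      by rewrite -EFinB -EFinM.
    apply: ge0_le_integral.
    - exact: measurable_itv.
    - by move=> x _; rewrite /= lee_fin; lra.
    - exact: measurable_cst.
    - exact: measurable_funTS.
    - by move=> x; rewrite /= lee_fin; exact: gcd.
  apply: ge0_subset_integral => //; first exact: measurable_funTS.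
  by move=> x _; rewrite lee_fin normr_ge0.
move=> h; rewrite -lte_fin /Rintegral fineK; last exact: integrable_fin_num.
by apply: lt_le_trans h; rewrite lte_fin mulr_gt0 //; lra.
Qed.

Lemma Rintegral_linear (c : R) f g : continuous f -> continuous g ->
  \int[mu]_(x in `[l, u]) (c * f x + g x) =
  c * \int[mu]_(x in `[l, u]) f x + \int[mu]_(x in `[l, u]) g x.
Proof.
move=> cf cg; rewrite RintegralD //=.
- by rewrite RintegralZl //; exact: continuous_integrable_itv.
- apply: (@continuous_integrable_itv (fun x => c * f x)) => x.
  by apply: cvgM; [exact: cvg_cst|exact: cf].
- exact: continuous_integrable_itv.
Qed.

End SegmentIntegral.

(** * Orthonormal polynomials of a weight *)

Section WeightedIntegral.
Variable R : realType.
Implicit Types (l u : R) (f w : R -> R) (p v : {poly R}).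

Definition wint l u f p : R := \int[lebesgue_measure]_(x in `[l, u]) (f x * p.[x]).

Lemma poly_eq0_itv l u p : l < u -> (forall x, l < x < u -> p.[x] = 0) -> p = 0.
Proof.
move=> lu p0; apply/eqP/contraT => pn0.
(* More distinct roots than the degree allows. *)
pose t (i : nat) : R := l + (u - l) / i.+2%:R.
have tlu i : l < t i < u.
  have h : 0 < (u - l) / i.+2%:R by apply: divr_gt0; rewrite ?subr_gt0 ?ltr0n.
  have h2 : (u - l) / i.+2%:R < u - l.
    by rewrite ltr_pdivrMr ?ltr0n // ltr_pMr ?subr_gt0 // ltr1n.
  by rewrite /t ltrDl h -ltrBrDl h2.
have ti : injective t.
  move=> i j /addrI /mulfI; rewrite subr_eq0 gt_eqF // => /(_ isT).
  by move=> /invr_inj /eqP; rewrite eqr_nat => /eqP[].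
have := @max_poly_roots _ p [seq t i | i <- iota 0 (size p)] pn0.
rewrite map_inj_uniq // iota_uniq size_map size_iota ltnn => -> //.
by apply/allP => _ /mapP[i _ ->]; rewrite /root p0.
Qed.

Lemma continuous_weighted f p : continuous f -> continuous (fun x => f x * p.[x]).
Proof.
by move=> cf x; apply: cvgM; [exact: cf|exact: continuous_horner].
Qed.

Lemma wint_functional l u f : l < u -> continuous f -> functional (wint l u f).
Proof.
move=> lu cf c p v; rewrite /wint -Rintegral_linear //; last 2 first.
  exact: continuous_weighted.
  exact: continuous_weighted.
by congr (Rintegral _ _ _); apply/funext => x; rewrite hornerD hornerZ; ring.
Qed.

Lemma wint_pos l u f p : l < u -> continuous f ->
  (forall x, l < x < u -> 0 < f x) -> p != 0 -> 0 < wint l u f (p * p).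
Proof.
move=> lu cf f0 p0.
have [x0 [x0lu px0]] : exists x, l < x < u /\ p.[x] != 0.
  apply: contrapT => h; move/eqP: p0; apply; apply: (poly_eq0_itv lu) => x xlu.
  by apply: contrapT => px; apply: h; exists x; split=> //; exact/eqP.
apply: (@Rintegral_gt0 _ _ _ _ x0) => //; first exact: continuous_weighted.
- by move=> x /f0 fx; rewrite hornerM -expr2 mulr_ge0 ?sqr_ge0 // ltW.
- by rewrite hornerM -expr2 mulr_gt0 ?f0 // exprn_even_gt0.
Qed.

(** Changing a weight at the end points changes no integral, so a weight need
    only agree with a continuous positive function inside the interval. *)
Lemma orthopoly_orthonormal l u w f : l < u -> continuous f ->
  (forall x, l < x < u -> 0 < f x) -> {in `]l, u[, w =1 f} ->
  orthonormal_for (wint l u f) (orthopoly l u w).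
Proof.
move=> lu cf f0 wf.
have wE p v : \int[lebesgue_measure]_(x in `[l, u]) (w x * p.[x] * v.[x]) =
    wint l u f (p * v).
  apply: Rintegral_eq_oo => //; last exact: continuous_weighted.
  by move=> x xlu; rewrite wf // hornerM mulrA.
have [] : orthonormal_polys l u w (orthopoly l u w).
  apply: (@xgetPex _ _ [set p | orthonormal_polys l u w p]).
  have [sg lg] := gram_schmidt_orthonormal (wint_functional lu cf)
    (fun p => wint_pos lu cf f0).
  by exists (gram_schmidt (wint l u f)); split=> // m n; rewrite wE.
by move=> so lo; split=> // m n; rewrite -wE.
Qed.

(** Polynomial factors of a weight are moved to the argument, so that different
    weights can be compared through one functional. *)
Lemma orthonormal_wintM l u f p (o : nat -> {poly R}) :
  orthonormal_for (wint l u (fun x => f x * p.[x])) o ->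
  orthonormal_for (fun v => wint l u f (p * v)) o.
Proof.
move=> [so lo]; split=> // m n; rewrite -lo /wint.
by congr (Rintegral _ _ _); apply/funext => x; rewrite [in LHS]hornerM mulrA.
Qed.

Lemma wintM_functional l u f p : l < u -> continuous f ->
  functional (fun v => wint l u f (p * v)).
Proof.
by move=> lu cf c v1 v2; rewrite mulrDr -scalerAr wint_functional.
Qed.

Lemma wint1_deriv l u p : l < u -> wint l u (fun=> 1) p^`() = p.[u] - p.[l].
Proof.
move=> lu; rewrite /wint (_ : (fun x => _) = horner p^`()); last first.
  by apply/funext => x; rewrite mul1r.
apply: (Rintegral_FTC lu (F := horner p)).
- exact: continuous_horner.
- exact: continuous_horner.
Qed.

Lemma poly_antideriv p : exists v, v^`() = p.
Proof.
exists (\poly_(i < (size p).+1) (p`_i.-1 / i%:R)); apply/polyP => i.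
rewrite coef_deriv coef_poly ltnS.
have [ip|ip] := ltnP i (size p).
  by rewrite -[LHS]mulr_natr divfK // pnatr_eq0.
by rewrite mul0rn nth_default.
Qed.

(** If v is an antiderivative of p, then - v(-x) is one of p(-x). *)
Lemma wint1_comp_opp u p : - u < u ->
  wint (- u) u (fun=> 1) (p \Po - 'X) = wint (- u) u (fun=> 1) p.
Proof.
move=> lu; have [v vp] := poly_antideriv p.
have -> : p \Po - 'X = (- (v \Po - 'X))^`().
  by rewrite derivN deriv_comp derivN derivX mulrN1 opprK vp.
rewrite -vp !wint1_deriv // !hornerN !horner_comp !hornerN !hornerX opprK.
by rewrite addrC opprK.
Qed.

End WeightedIntegral.

(** * The domain and its boundary function *)

Section BoundaryFunction.
Variables (R : realType) (al be ga de : R) (rho : R -> R) (eta : bool) (q : {poly R}).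
Hypothesis rho_gt0 : forall x, al < x < be -> 0 < rho x.
Hypothesis rho_q : rho_case al be ga de rho eta q.

Lemma is_derive_horner (p : {poly R}) (x : R) : is_derive x 1 (horner p) p^`().[x].
Proof.
by rewrite derivE derive1E; apply: derivableP; exact: derivable_horner.
Qed.

(** The hypotheses describe rho on the segment only; this function agrees with it
    there and is continuous on the whole line. *)
Definition rho_ext (x : R) : R := if eta then Num.sqrt q.[x] else q.[x].

Definition rho_sqr : {poly R} := if eta then q else q ^+ 2.

Lemma continuous_rho_ext : continuous rho_ext.
Proof.
move=> x; rewrite /rho_ext; case: eta; last exact: continuous_horner.
by apply: continuous_comp; [exact: continuous_horner|exact: sqrt_continuous].
Qed.

Lemma rho_extE x : al < x < be -> rho x = rho_ext x.
Proof. by case: rho_q => rq _ /andP[/ltW ax /ltW xb]; rewrite rq ?ax. Qed.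

Lemma rho_ext_gt0 x : al < x < be -> 0 < rho_ext x.
Proof. by move=> xab; rewrite -rho_extE ?rho_gt0. Qed.

Lemma rho_ext_sqr x : al < x < be -> rho_ext x ^+ 2 = rho_sqr.[x].
Proof.
move=> /rho_ext_gt0; rewrite /rho_ext /rho_sqr; case: eta => [|_].
  by rewrite sqrtr_gt0 => /ltW /sqr_sqrtr.
by rewrite horner_exp.
Qed.

Lemma near_interior x : al < x < be -> \near x, al < x < be.
Proof.
move=> /andP[ax xb]; near=> t; apply/andP; split; near: t.
  exact: lt_nbhsr.
exact: lt_nbhsl.
Unshelve. all: by end_near. Qed.

Lemma is_derive_rho_ext x : al < x < be ->
  is_derive x 1 rho_ext (rho_sqr^`().[x] / (2 * rho_ext x)).
Proof.
move=> xab; have := rho_ext_gt0 xab; rewrite /rho_sqr /rho_ext.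
case: eta => [|].
  rewrite sqrtr_gt0 => q0.
  apply: (is_derive_eq (is_derive1_comp (is_derive1_sqrt q0) (is_derive_horner q x))).
  by rewrite mulrC.
move=> q0; apply: (is_derive_eq (is_derive_horner q x)).
rewrite expr2 derivM hornerD !hornerM; field.
by rewrite gt_eqF.
Qed.

Lemma nbhs_lower_lt (a x : R) : (\near x, a <= x) -> a < x.
Proof.
move=> /nbhs_ballP[e /= e0 H]; have := H (x - e / 2).
rewrite /ball /= opprB addrCA subrr addr0 gtr0_norm ?divr_gt0 //.
have e2 : e / 2 < e by rewrite ltr_pdivrMr // ltr_pMr // ltr1n.
by move=> /(_ e2) /le_lt_trans; apply; rewrite ltrBlDr ltrDl divr_gt0.
Qed.

Lemma nbhs_upper_lt (b x : R) : (\near x, x <= b) -> x < b.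
Proof.
move=> /nbhs_ballP[e /= e0 H]; have := H (x + e / 2).
rewrite /ball /= opprD addrA subrr add0r normrN gtr0_norm ?divr_gt0 //.
have e2 : e / 2 < e by rewrite ltr_pdivrMr // ltr_pMr // ltr1n.
by move=> /(_ e2); apply: lt_le_trans; rewrite ltrDl divr_gt0.
Qed.

(** A point on one of the four boundary curves has points outside Omega next to
    it; conversely the four strict inequalities are open conditions, because rho
    is continuous. *)
Lemma interior_OmegaE (x y : R) :
  (Omega al be ga de rho)° (x, y) <->
  al < x < be /\ ga * rho x < y < de * rho x.
Proof.
split=> [Oxy|[xab yab]].
  have sub (z : R * R) : (Omega al be ga de rho)° z -> Omega al be ga de rho z.
    exact: interior_subset.
  have nx := open_near_x (@open_interior _ _) Oxy.
  have ny := open_near_y (@open_interior _ _) Oxy.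
  split; apply/andP; split.
  - by apply: nbhs_lower_lt; apply: filterS nx => t /sub[/andP[]].
  - by apply: nbhs_upper_lt; apply: filterS nx => t /sub[/andP[]].
  - by apply: nbhs_lower_lt; apply: filterS ny => t /sub[_ /andP[]].
  - by apply: nbhs_upper_lt; apply: filterS ny => t /sub[_ /andP[]].
move: xab yab => xab; have [ax xb] := andP xab; rewrite rho_extE // => /andP[gy yd].
have cr c : (fun z : R * R => z.2 - c * rho_ext z.1) z @[z --> (x, y)] -->
    y - c * rho_ext x.
  apply: cvgB; first exact: cvg_snd.
  apply: cvgM; first exact: cvg_cst.
  have cx : z.1 @[z --> (x, y)] --> x by exact: cvg_fst.
  exact: (cvg_comp _ rho_ext cx (@continuous_rho_ext x)).
have g0 : 0 < y - ga * rho_ext x by rewrite subr_gt0.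
have d0 : y - de * rho_ext x < 0 by rewrite subr_lt0.
have cx : z.1 @[z --> (x, y)] --> x by exact: cvg_fst.
have ca : \forall z \near (x, y), al < z.1 by apply: (cvgr_gt _ cx).
have cb : \forall z \near (x, y), z.1 < be by apply: (cvgr_lt _ cx).
have cg : \forall z \near (x, y), 0 < z.2 - ga * rho_ext z.1.
  exact: (cvgr_gt _ (cr ga)).
have cd : \forall z \near (x, y), z.2 - de * rho_ext z.1 < 0.
  exact: (cvgr_lt _ (cr de)).
apply: filterS (filterI (filterI ca cb) (filterI cg cd)) => z /=.
move=> [[az zb] [gz dz]]; rewrite subr_gt0 in gz; rewrite subr_lt0 in dz.
by rewrite /Omega /= rho_extE ?az // !ltW.
Qed.

(** The operator e - t d/dt; it kills the monomial of degree e. *)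
Definition euler e (g : {poly R}) : {poly R} := g *+ e - 'X * g^`().

(** All the functions that are differentiated have this shape; the argument
    y / rho is called the slope. *)
Definition sep (p : {poly R}) e (g : {poly R}) (x y : R) : R :=
  p.[x] * rho x ^+ e * g.[y / rho x].

(** Since rho' = (rho^2)' / (2 rho), differentiation in x keeps the shape up to
    division by rho^2, and brings in the Euler operator e - t d/dt. *)
Lemma is_derive_sep_x p e g (x y : R) : al < x < be ->
  is_derive x 1 (fun x => sep p e g x y)
    (p^`().[x] * rho x ^+ e * g.[y / rho x] +
     2^-1 * (p.[x] * rho_sqr^`().[x] * rho x ^+ e / rho x ^+ 2 *
       (euler e g).[y / rho x])).
Proof.
move=> xab; have r0 : rho x != 0 by rewrite gt_eqF ?rho_gt0.
have dr : is_derive x 1 rho (rho_sqr^`().[x] / (2 * rho x)).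
  rewrite (rho_extE xab); apply: near_eq_is_derive (is_derive_rho_ext xab).
  by apply: filterS (near_interior xab) => t /rho_extE.
have dV : is_derive x 1 (fun x => y / rho x)
    (- y * rho x ^- 2 * (rho_sqr^`().[x] / (2 * rho x))).
  apply: (@is_derive_eq _ _ _ (fun x => y *: (rho x)^-1)).
  rewrite /GRing.scale /=; ring.
have dg := @is_derive1_comp _ (horner g) (fun x => y / rho x) x _ _
  (is_derive_horner g (y / rho x)) dV.
have dre := is_deriveX e dr.
rewrite (_ : (fun t => sep p e g t y) =
  horner p * rho ^+ e * (horner g \o (fun x => y / rho x))); last first.
  by apply/funext => t; rewrite /sep !fctE /=.
apply: (is_derive_eq (is_deriveM (is_deriveM (is_derive_horner p x) dre) dg)).
rewrite /GRing.scale /euler /= !hornerE hornerMn /=.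
case: e {dre} => [|e]; rewrite !fctE /=.
  by field.
by rewrite !exprS; field.
Qed.

Lemma is_derive_sep_y p e g (x y : R) :
  is_derive y 1 (sep p e g x) (p.[x] * rho x ^+ e / rho x * g^`().[y / rho x]).
Proof.
have dV : is_derive y 1 (fun y => y / rho x) (rho x)^-1.
  rewrite (_ : (fun y => y / rho x) = (rho x)^-1 *: id); last first.
    by apply/funext => t; rewrite !fctE /GRing.scale /= mulrC.
  apply: (is_derive_eq (is_deriveZ (rho x)^-1 (is_derive_id y 1))).
  by rewrite /GRing.scale /= mulr1.
have dg := @is_derive1_comp _ (horner g) (fun y => y / rho x) y _ _
  (is_derive_horner g (y / rho x)) dV.
rewrite (_ : sep p e g x = (p.[x] * rho x ^+ e) *: (horner g \o (fun y => y / rho x))) //.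
apply: (is_derive_eq (is_deriveZ (p.[x] * rho x ^+ e) dg)).
by rewrite /GRing.scale /=; ring.
Qed.

End BoundaryFunction.

(** * The two families of univariate polynomials *)

Section Edge.
Variable R : realType.

(** Both weights are powers of such polynomials, zero at the ends of the
    interval and positive inside. *)
Definition edge (l u : R) : {poly R} := (u%:P - 'X) * ('X - l%:P).

Lemma edgeE (l u x : R) : (edge l u).[x] = (u - x) * (x - l).
Proof. by rewrite !hornerE. Qed.

Lemma size_edge (l u : R) : size (edge l u) = 3%N.
Proof.
rewrite /edge -opprB mulNr size_polyN size_Mmonic ?monicXsubC //.
  by rewrite !size_XsubC.
by rewrite polyXsubC_eq0.
Qed.

Lemma edge_neq0 (l u : R) : edge l u != 0.
Proof. by rewrite -size_poly_gt0 size_edge. Qed.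

Lemma edge_gt0 (l u x : R) : l < x < u -> 0 < (edge l u).[x].
Proof. by move=> /andP[lx xu]; rewrite edgeE mulr_gt0 ?subr_gt0. Qed.

(** This is (w^(C+1) g)' / w^C: differentiation lowers the exponent of the
    weight by one. *)
Definition deriv_quot (w : {poly R}) C (g : {poly R}) : {poly R} :=
  (w^`() * g) *+ C.+1 + w * g^`().

Lemma deriv_quotE w C g : (w ^+ C.+1 * g)^`() = w ^+ C * deriv_quot w C g.
Proof.
rewrite derivM deriv_exp /deriv_quot /=.
by rewrite exprS; ring.
Qed.

Lemma size_deriv_quot (l u : R) C g : (size (deriv_quot (edge l u) C g) <= (size g).+1)%N.
Proof.
have [->|g0] := eqVneq g 0; first by rewrite /deriv_quot deriv0 !mulr0 mul0rn addr0 size_poly0.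
have g1 : (0 < size g)%N by rewrite size_poly_gt0.
apply: (leq_trans (size_polyD _ _)); rewrite geq_max; apply/andP; split.
  rewrite -scaler_nat; apply: (leq_trans (size_scale_leq _ _)); apply: (leq_trans (size_polyMleq _ _)).
  have := lt_size_deriv (edge_neq0 l u); rewrite size_edge; lia.
apply: (leq_trans (size_polyMleq _ _)); rewrite size_edge.
have := lt_size_deriv g0; lia.
Qed.

End Edge.

Section Univariate.
Variables (R : realType) (al be ga de : R) (rho : R -> R) (eta : bool) (q : {poly R}).
Hypotheses (lt_al_be : al < be) (lt_ga_de : ga < de).
Hypothesis rho_gt0 : forall x, al < x < be -> 0 < rho x.
Hypothesis rho_q : rho_case al be ga de rho eta q.

Local Notation r := (rho_ext eta q).
Local Notation r2 := (rho_sqr eta q).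

(** Only the power of rho is part of the functional: the other factors of the
    weights are polynomials and stay in the argument. *)
Definition intx s (p : {poly R}) : R := wint al be (fun x => r x ^+ s) p.

Definition inty (p : {poly R}) : R := wint ga de (fun=> 1) p.

Lemma continuous_rho_exp s : continuous (fun x => r x ^+ s).
Proof.
move=> x; apply: (@continuous_comp _ _ _ r (fun z => z ^+ s)).
  exact: continuous_rho_ext.
exact: exprn_continuous.
Qed.

Lemma intx_functional s : functional (intx s).
Proof. by apply: wint_functional => //; exact: continuous_rho_exp. Qed.

Lemma inty_functional : functional inty.
Proof. by apply: wint_functional => // x; exact: cvg_cst. Qed.

Lemma inty_deriv p : p.[ga] = 0 -> p.[de] = 0 -> inty p^`() = 0.
Proof. by move=> pg pd; rewrite /inty wint1_deriv // pg pd subrr. Qed.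

(** The derivative of p rho^(s+2) is p' rho^(s+2) + (s+2)/2 p (rho^2)' rho^s.
    Since rho^2 is a polynomial in both cases, so is every factor but the power
    of rho. *)
Lemma intx_by_parts s p : p.[al] = 0 -> p.[be] = 0 ->
  intx s.+2 p^`() + s.+2%:R / 2 * intx s (p * r2^`()) = 0.
Proof.
move=> pa pb; rewrite addrC /intx /wint -Rintegral_linear //; last 2 first.
  by apply: continuous_weighted; exact: continuous_rho_exp.
  by apply: continuous_weighted; exact: continuous_rho_exp.
have F0 : r be ^+ s.+2 * p.[be] - r al ^+ s.+2 * p.[al] = 0.
  by rewrite pa pb !mulr0 subrr.
rewrite -[RHS]F0; apply: (Rintegral_FTC lt_al_be (F := fun x => r x ^+ s.+2 * p.[x])).
- by apply: continuous_weighted; exact: continuous_rho_exp.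
- move=> x; apply: cvgD.
    apply: cvgM; first exact: cvg_cst.
    exact: (continuous_weighted (@continuous_rho_exp s)).
  exact: (continuous_weighted (@continuous_rho_exp s.+2)).
move=> x xab; have r0 := rho_ext_gt0 rho_gt0 rho_q xab.
have dr := is_deriveX s.+2 (is_derive_rho_ext rho_gt0 rho_q xab).
rewrite (_ : (fun x => r x ^+ s.+2 * p.[x]) = r ^+ s.+2 * horner p); last first.
  by apply/funext => t; rewrite !fctE.
apply: (is_derive_eq (is_deriveM dr (is_derive_horner p x))).
rewrite /GRing.scale /= !fctE hornerM !exprS; field.
by rewrite gt_eqF.
Qed.

(** The parameters that occur are a = b = A and c = d = C with A and C natural;
    the exponent of rho is then 2 C + 2 k + 1. *)
Definition polyx A C k : nat -> {poly R} :=
  Rpoly al be rho A%:R A%:R (C%:R + C%:R + (2 * k + 1)%:R).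

Definition polyy C : nat -> {poly R} := Ppoly ga de C%:R C%:R.

Local Notation phi := (edge al be).
Local Notation om := (edge ga de).

Lemma polyx_orthonormal A C k :
  orthonormal_for (fun v => intx (2 * (C + k) + 1) (phi ^+ A * v)) (polyx A C k).
Proof.
apply: orthonormal_wintM; apply: orthopoly_orthonormal => //.
- by apply: continuous_weighted; exact: continuous_rho_exp.
- move=> x xab; rewrite horner_exp mulr_gt0 // exprn_gt0 ?edge_gt0 //.
  exact: (rho_ext_gt0 rho_gt0 rho_q).
move=> x; rewrite in_itv /= => xab; have /andP[ax xb] := xab.
have -> : C%:R + C%:R + (2 * k + 1)%:R = (2 * (C + k) + 1)%:R :> R.
  by rewrite -!natrD; congr (_%:R); clear; lia.
rewrite /wR !powR_mulrn ?subr_ge0 ?ltW ?rho_gt0 // (rho_extE rho_q xab).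
by rewrite horner_exp edgeE exprMn mulrC.
Qed.

Lemma polyy_orthonormal C :
  orthonormal_for (fun v => inty (om ^+ C * v)) (polyy C).
Proof.
apply: orthonormal_wintM; apply: orthopoly_orthonormal => //.
- by apply: continuous_weighted => x; exact: cvg_cst.
- by move=> x xab; rewrite mul1r horner_exp exprn_gt0 ?edge_gt0.
move=> x; rewrite in_itv /= => /andP[ax xb].
by rewrite /wP !powR_mulrn ?subr_ge0 ?ltW // mul1r horner_exp edgeE exprMn.
Qed.

Lemma size_polyx A C k m : size (polyx A C k m) = m.+1.
Proof. by have [/(_ m)[]] := polyx_orthonormal A C k. Qed.

Lemma size_polyy C k : size (polyy C k) = k.+1.
Proof. by have [/(_ k)[]] := polyy_orthonormal C. Qed.

Lemma intx_phi_functional s A : functional (fun v => intx s (phi ^+ A * v)).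
Proof. by apply: wintM_functional => //; exact: continuous_rho_exp. Qed.

Lemma inty_om_functional C : functional (fun v => inty (om ^+ C * v)).
Proof. by apply: wintM_functional => // x; exact: cvg_cst. Qed.

(** The exponent 2 C + 2 k + 1 depends on C + k only. This is why
    differentiation in y leaves the factor in x alone. *)
Lemma polyx_shift A C k : polyx A C k.+1 = polyx A C.+1 k.
Proof.
rewrite /polyx; congr (Rpoly _ _ _ _ _ _).
by rewrite -!natrD; congr (_%:R); clear; lia.
Qed.

Lemma polyy_parity C n : eta -> polyy C n \Po - 'X = (-1) ^+ n *: polyy C n.
Proof.
case: rho_q => _ sym /sym[dg d0]; apply: (orthonormal_parity (@inty_om_functional C) (@polyy_orthonormal C)).
move=> u; have ge : ga = - de by rewrite dg opprK.
have omN : om \Po - 'X = om.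
  rewrite /edge ge polyCN opprK comp_polyM !raddfB !raddfD /= !comp_polyC.
  by rewrite comp_polyX; ring.
rewrite -{1}omN -rmorphXn /= -comp_polyM /inty ge wint1_comp_opp //.
by rewrite (lt_trans _ d0) // oppr_lt0.
Qed.

Lemma inty_odd u : eta -> u \Po - 'X = - u -> inty u = 0.
Proof.
case: rho_q => _ sym /sym[dg d0] uN; have ge : ga = - de by rewrite dg opprK.
have : inty (u \Po - 'X) = inty u.
  by rewrite /inty ge wint1_comp_opp // (lt_trans _ d0) // oppr_lt0.
by rewrite uN (functionalN inty_functional) => /eqP; rewrite eqNr => /eqP.
Qed.

End Univariate.

(** * Block matrices given by their action on the two indices *)

Section IndexedMatrices.
Variable R : realType.
Implicit Types (mu : nat -> nat -> nat -> nat -> R) (D : set (R * R)).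

(** Entry k of block n is indexed by the pair (n - k, k) of the degrees of its
    two univariate factors; mu m' k' m k is the coefficient of the function of
    index (m', k') in the image of the function of index (m, k). *)
Definition bmx_of mu : bmx R :=
  fun i j => \matrix_(k' < i.+1, k < j.+1) mu (i - k')%N k' (j - k)%N k.

(** Pairs of degrees are regrouped by their total degree. *)
Lemma triangle_sum (a : nat -> nat -> R) N :
  (forall m k, (N <= m + k)%N -> a m k = 0) ->
  \sum_(k < N) \sum_(m < N) a m k = \sum_(n < N) \sum_(k < n.+1) a (n - k)%N k.
Proof.
move=> a0; have -> : \sum_(n < N) \sum_(k < n.+1) a (n - k)%N k =
    \sum_(n < N) \sum_(k < N | (k <= n)%N) a (n - k)%N k.
  apply: eq_bigr => n _; rewrite (big_ord_widen N (fun k => a (n - k)%N k)) //.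
rewrite [RHS](exchange_big_dep xpredT) //=; apply: eq_bigr => k _.
transitivity (\sum_(k <= n < N) a (n - k)%N k); last first.
  by rewrite (big_nat_widenl k 0) // big_mkord.
have := big_addn 0 N k xpredT (fun n => a (n - k)%N k).
rewrite add0n => ->.
under [RHS]eq_bigr => m _ do rewrite addnK.
rewrite big_mkord [RHS](big_ord_widen N (fun m => a m k)) ?leq_subr //.
rewrite [RHS]big_mkcond; apply: eq_bigr => m _; case: ifP => // /negbT.
by rewrite -leqNgt leq_subLR addnC => /a0.
Qed.

Lemma represents_bmx_of D (F G : frow R) (f g : nat -> nat -> R -> R -> R) mu d :
  (forall n (k : 'I_n.+1) x y, D (x, y) -> F n k x y = f (n - k)%N k x y) ->
  (forall n (k : 'I_n.+1) x y, D (x, y) -> G n k x y = g (n - k)%N k x y) ->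
  (forall m' k' m k, mu m' k' m k != 0 -> (m' + k' <= m + k + d)%N) ->
  (forall m k x y, D (x, y) ->
    f m k x y = \sum_(k' < (m + k + d).+1) \sum_(m' < (m + k + d).+1)
      g m' k' x y * mu m' k' m k) ->
  represents D F G (bmx_of mu).
Proof.
move=> Ff Gg mu0 fg; apply: represents_trunc => n; exists (n + d).+1.
  move=> i ni; apply/matrixP => k' k; rewrite !mxE; apply/eqP/contraT => /mu0.
  by have := ltn_ord k'; have := ltn_ord k; lia.
move=> k x y Dxy; rewrite Ff // fg // subnK -1?ltnS ?ltn_ord //.
rewrite (triangle_sum (a := fun m' k' => g m' k' x y * mu m' k' (n - k)%N k)).
  apply: eq_bigr => m _; apply: eq_bigr => j _; rewrite mxE Gg //.
move=> m' k' mk; have [->|/mu0] := eqVneq (mu m' k' (n - k)%N k) 0.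
  by rewrite mulr0.
by have := ltn_ord k; lia.
Qed.

Lemma banded_bmx_of mu s t s' t' :
  (forall m' k' m k, mu m' k' m k != 0 ->
    [/\ (m' + k' <= m + k + s)%N, (m + k <= m' + k' + t)%N,
        (k' <= k + s')%N & (k <= k' + t')%N]) ->
  banded_bmx s t s' t' (bmx_of mu).
Proof.
move=> H; split=> i j.
  move=> ij; apply/matrixP => k' k; rewrite !mxE; apply/eqP/contraT => /H[].
  by have := ltn_ord k'; have := ltn_ord k; lia.
by move=> k' k kk; rewrite mxE; apply/eqP/contraT => /H[]; lia.
Qed.

Lemma independent_indexed D (G : frow R) (g : nat -> nat -> R -> R -> R) :
  (forall n (k : 'I_n.+1) x y, D (x, y) -> G n k x y = g (n - k)%N k x y) ->
  (forall (c : nat -> nat -> R) N,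
    (forall x y, D (x, y) -> \sum_(k < N) \sum_(m < N) g m k x y * c m k = 0) ->
    forall m k, (m < N)%N -> (k < N)%N -> c m k = 0) ->
  independent D G.
Proof.
move=> Gg ig c N cG n nN k.
pose e m k := if (m + k < N)%N then c (m + k)%N (inord k) else 0.
have := ig e N; move=> /(_ _ (n - k)%N k).
have kn : (k <= n)%N by rewrite -ltnS.
rewrite /e subnK // nN inord_val; apply; [|lia|lia].
move=> x y Dxy; rewrite (triangle_sum (a := fun m k => g m k x y *
  (if (m + k < N)%N then c (m + k)%N (inord k) else 0))); last first.
  by move=> m k'; rewrite leqNgt => /negPf ->; rewrite mulr0.
rewrite -[RHS](cG x y Dxy); apply: eq_bigr => m _; apply: eq_bigr => j _.
have jm : (j <= m)%N by rewrite -ltnS.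
by rewrite Gg // subnK // ltn_ord inord_val.
Qed.

End IndexedMatrices.

(** * Coefficients in the slope variable *)

Section SlopeCoefficients.
Variables (R : realType) (al be ga de : R) (rho : R -> R) (eta : bool) (q : {poly R}).
Hypothesis lt_ga_de : ga < de.
Hypothesis rho_q : rho_case al be ga de rho eta q.

Local Notation om := (edge ga de).
Local Notation P := (polyy ga de).
Local Notation Y := (inty ga de).

Lemma coef_euler e (g : {poly R}) i : (euler e g)`_i = (e%:R - i%:R) * g`_i.
Proof.
rewrite /euler coefB coefMn coefXM; case: i => [|i] /=.
  by rewrite !subr0 mulr_natl.
by rewrite coef_deriv; ring.
Qed.

Lemma size_euler e (g : {poly R}) : (size g <= e.+1)%N -> (size (euler e g) <= e)%N.
Proof.
move=> ge; apply/leq_sizeP => j; rewrite coef_euler leq_eqVlt.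
move=> /predU1P[->|ej]; first by rewrite subrr mul0r.
by rewrite [g`_j]nth_default ?mulr0 // (leq_trans ge).
Qed.

(** The degrees add because t d/dt is a derivation. *)
Lemma euler_mul d e (g v : {poly R}) :
  euler (d + e) (g * v) = euler d g * v + g * euler e v.
Proof.
rewrite /euler derivM mulrnDr mulrDr mulrBl mulrBr mulrnAl mulrnAr -!mulrA.
by rewrite (mulrCA g 'X) opprD !addrA; congr (_ - _); rewrite addrAC.
Qed.

Lemma deriv_mulX n (g : {poly R}) : ('X * g)^`() = g *+ n.+1 - euler n g.
Proof.
by rewrite /euler derivM derivX mul1r mulrS opprB addrA addrAC addrK addrC.
Qed.

Lemma euler_parity e n (g : {poly R}) :
  g \Po - 'X = (-1) ^+ n *: g -> euler e g \Po - 'X = (-1) ^+ n *: euler e g.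
Proof.
move=> gN; have dgN : g^`() \Po - 'X = - ((-1) ^+ n *: g^`()).
  have := congr1 (@deriv _) gN; rewrite deriv_comp derivN derivX derivZ mulrN1.
  by move=> <-; rewrite opprK.
rewrite /euler raddfB raddfMn /= comp_polyM comp_polyX dgN gN mulrNN.
by rewrite scalerBr -scalerAr scalerMnr.
Qed.

Lemma om_exp_parity C : eta -> om ^+ C \Po - 'X = om ^+ C.
Proof.
case: rho_q => _ sym /sym[dg d0]; have ge : ga = - de by rewrite dg opprK.
rewrite rmorphXn /= /edge ge polyCN opprK comp_polyM !raddfB !raddfD /=.
by rewrite !comp_polyC comp_polyX; congr (_ ^+ _); ring.
Qed.

(** This is euler e (om^(C+1) g) / om^C. *)
Definition euler_quot C e (g : {poly R}) : {poly R} :=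
  (om * g) *+ e - 'X * deriv_quot om C g.

Lemma euler_quotE C e (g : {poly R}) : euler e (om ^+ C.+1 * g) = om ^+ C * euler_quot C e g.
Proof.
by rewrite /euler /euler_quot deriv_quotE exprS; ring.
Qed.

Lemma size_om_exp C : size (om ^+ C) = (2 * C).+1.
Proof. by rewrite polySpred ?expf_neq0 ?edge_neq0 // size_exp size_edge. Qed.

(** Here e is the degree of om^(C+1) g, whose leading term the Euler operator
    kills; without this the degree bound would be one more. *)
Lemma size_euler_quot C k (g : {poly R}) : size g = k.+1 ->
  (size (euler_quot C (2 * C + 2 + k) g) <= k + 2)%N.
Proof.
move=> gk; have [->|e0] := eqVneq (euler_quot C (2 * C + 2 + k) g) 0.
  by rewrite size_poly0.
have : (size (euler (2 * C + 2 + k) (om ^+ C.+1 * g)) <= 2 * C + 2 + k)%N.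
  apply: size_euler; apply: (leq_trans (size_polyMleq _ _)).
  by rewrite size_om_exp gk; lia.
rewrite euler_quotE size_mul // ?size_om_exp; last first.
  by rewrite -size_poly_gt0 size_om_exp.
by set n := size _; lia.
Qed.

(** The first three are the coefficients along P^(C+1)_k' of P^C_k, of its
    derivative and of its image by the Euler operator of order k. The last one is
    the coefficient along P^C_k of the image of om^(C+1) P^(C+1)_k' by the Euler
    operator of order equal to its degree, after division by om^C. *)
Definition coefy C k' k := Y (om ^+ C.+1 * (P C.+1 k' * P C k)).
Definition coefy_deriv C k' k := Y (om ^+ C.+1 * (P C.+1 k' * (P C k)^`())).
Definition coefy_euler C k' k := Y (om ^+ C.+1 * (P C.+1 k' * euler k (P C k))).
Definition coefy_euler' C k' k :=
  Y (euler (2 * C + 2 + k') (om ^+ C.+1 * P C.+1 k') * P C k).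

Lemma om_eq0 g C : (om ^+ C.+1 * g).[ga] = 0 /\ (om ^+ C.+1 * g).[de] = 0.
Proof. by rewrite !hornerM !horner_exp !edgeE !subrr mulr0 mul0r expr0n /= !mul0r. Qed.

(** With u = om^(C+1) P_k' P_k, the derivative of t u has integral 0, since u
    vanishes at both ends; the Euler operator of a product splits in two. *)
Lemma coefy_eulerD C k' k : coefy_euler C k' k + coefy_euler' C k' k =
  (k + k' + 2 * C + 3)%:R * coefy C k' k.
Proof.
have Yl := inty_functional lt_ga_de.
pose u := om ^+ C.+1 * (P C.+1 k' * P C k).
have u0 : Y ('X * u)^`() = 0.
  have [pg pd] := om_eq0 (P C.+1 k' * P C k) C.
  by apply: inty_deriv => //; rewrite hornerM (pg, pd) mulr0.
have -> : coefy_euler C k' k + coefy_euler' C k' k = Y (euler (2 * C + 2 + k' + k) u).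
  rewrite /coefy_euler /coefy_euler' -(functionalD Yl) addrC !mulrA.
  by rewrite -euler_mul /u mulrA.
move: u0; rewrite (deriv_mulX (2 * C + 2 + k' + k)) (functionalB Yl).
rewrite -scaler_nat (functionalZ Yl) => /subr0_eq <-.
by congr (_%:R * _); lia.
Qed.

(** Each of P_k' and P_k is orthogonal, for its own weight, to all lower
    degrees; the weights differ by the factor om, of degree 2. *)
Lemma coefy_eq0 C k' k : ~~ ((k' <= k) && (k <= k' + 2))%N -> coefy C k' k = 0.
Proof.
rewrite negb_and -!ltnNge => /orP[kk|kk].
  rewrite /coefy (mulrC (P C.+1 k')).
  apply: (orthonormal_low (inty_om_functional lt_ga_de C.+1)
    (polyy_orthonormal lt_ga_de C.+1)).
  by rewrite size_polyy.
rewrite /coefy exprSr -mulrA (mulrA om).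
apply: (orthonormal_low (inty_om_functional lt_ga_de C)
  (polyy_orthonormal lt_ga_de C)).
apply: (leq_trans (size_polyMleq _ _)); rewrite size_edge size_polyy //; lia.
Qed.

Lemma coefy_euler'_eq0_low C k' k : (k' + 2 <= k)%N -> coefy_euler' C k' k = 0.
Proof.
move=> kk; rewrite /coefy_euler' euler_quotE -mulrA.
apply: (orthonormal_low (inty_om_functional lt_ga_de C)
  (polyy_orthonormal lt_ga_de C)).
by rewrite (leq_trans _ kk) // size_euler_quot // size_polyy.
Qed.

(** For k <= k' the degree of the Euler image is too small. For large k it is
    that of the adjoint which is too small, and coefy_eulerD relates the two. *)
Lemma coefy_euler_eq0 C k' k : ~~ ((k' < k) && (k <= k' + 2))%N ->
  coefy_euler C k' k = 0.
Proof.
have [kk _|kk /= kk'] := leqP k k'.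
  rewrite /coefy_euler (mulrC (P C.+1 k')).
  apply: (orthonormal_low (inty_om_functional lt_ga_de C.+1)
    (polyy_orthonormal lt_ga_de C.+1)).
  by apply: leq_trans kk; apply: size_euler; rewrite size_polyy.
have := coefy_eulerD C k' k.
rewrite coefy_euler'_eq0_low; last by rewrite -ltnNge in kk'; lia.
rewrite coefy_eq0; last by rewrite negb_and kk' orbT.
by rewrite mulr0 addr0.
Qed.

Lemma coefy_euler'_eq0 C k' k : ~~ ((k' <= k) && (k < k' + 2))%N ->
  coefy_euler' C k' k = 0.
Proof.
have [kk _|kk] := leqP (k' + 2) k; first exact: coefy_euler'_eq0_low.
rewrite andbT => kk'; have := coefy_eulerD C k' k.
rewrite coefy_euler_eq0; last by rewrite negb_and; lia.
rewrite coefy_eq0; last by rewrite negb_and kk'.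
by rewrite mulr0 add0r.
Qed.

(** In case (ii) om is even and P_k has the parity of k, so the integrands are
    odd. *)
Lemma coefy_odd C k' k : eta -> odd (k + k') ->
  coefy C k' k = 0 /\ coefy_euler C k' k = 0.
Proof.
move=> et okk; have s : (-1) ^+ k' * (-1) ^+ k = -1 :> R.
  by rewrite -exprD -signr_odd addnC okk expr1.
have par g : g \Po - 'X = (-1) ^+ k *: g -> Y (om ^+ C.+1 * (P C.+1 k' * g)) = 0.
  move=> gN; apply: (inty_odd lt_ga_de rho_q et).
  rewrite !comp_polyM om_exp_parity // gN (polyy_parity lt_ga_de rho_q) //.
  by rewrite -scalerAl -!scalerAr scalerA s scaleN1r.
have PN := polyy_parity lt_ga_de rho_q C k et.
by split; apply: par => //; exact: euler_parity.
Qed.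

Lemma coefy_euler'_odd C k' k : eta -> odd (k + k') -> coefy_euler' C k' k = 0.
Proof.
move=> et okk; have [a0 b0] := coefy_odd C et okk.
by have := coefy_eulerD C k' k; rewrite a0 b0 mulr0 add0r.
Qed.

(** Differentiation lowers the degree by one and, after integration by parts,
    raises the degree of the other factor by at most one. *)
Lemma coefy_deriv_eq0 C k' k : k != k'.+1 -> coefy_deriv C k' k = 0.
Proof.
move=> kk'; have [kk|kk] := leqP k k'.
  rewrite /coefy_deriv (mulrC (P C.+1 k')).
  apply: (orthonormal_low (inty_om_functional lt_ga_de C.+1)
    (polyy_orthonormal lt_ga_de C.+1)).
  apply: leq_trans kk; rewrite -ltnS -(size_polyy lt_ga_de C k).
  by apply: lt_size_deriv; rewrite -size_poly_gt0 size_polyy.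
have Yl := inty_functional lt_ga_de.
have u0 : Y (om ^+ C.+1 * (P C.+1 k' * P C k))^`() = 0.
  by have [pg pd] := om_eq0 (P C.+1 k' * P C k) C; apply: inty_deriv.
have : Y (om ^+ C * (deriv_quot om C (P C.+1 k') * P C k)) = 0.
  apply: (orthonormal_low (inty_om_functional lt_ga_de C)
    (polyy_orthonormal lt_ga_de C)).
  have := size_deriv_quot ga de C (P C.+1 k'); rewrite size_polyy // => h.
  by apply: leq_trans h _; lia.
move: u0; rewrite mulrA derivM deriv_quotE (functionalD Yl) -!mulrA /coefy_deriv.
by move=> + h; rewrite h add0r.
Qed.

Lemma coefy_derivN C k' k :
  Y (om ^+ C * (deriv_quot om C (P C.+1 k') * P C k)) = - coefy_deriv C k' k.
Proof.
have Yl := inty_functional lt_ga_de.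
have : Y (om ^+ C.+1 * (P C.+1 k' * P C k))^`() = 0.
  by have [pg pd] := om_eq0 (P C.+1 k' * P C k) C; apply: inty_deriv.
rewrite mulrA derivM deriv_quotE (functionalD Yl) -!mulrA /coefy_deriv; lra.
Qed.

End SlopeCoefficients.

(** * Coefficients of the derivative in x *)

Section AbscissaCoefficients.
Variables (R : realType) (al be ga de : R) (rho : R -> R) (eta : bool) (q : {poly R}).
Hypothesis lt_al_be : al < be.
Hypothesis rho_gt0 : forall x, al < x < be -> 0 < rho x.
Hypothesis rho_q : rho_case al be ga de rho eta q.

Local Notation r := (rho_ext eta q).
Local Notation r2 := (rho_sqr eta q).
Local Notation I := (intx al be eta q).
Local Notation phi := (edge al be).
Local Notation om := (edge ga de).
Local Notation Rx := (polyx al be rho).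
Local Notation P := (polyy ga de).
Local Notation d := (deg_rho_sqr eta q).

Lemma rho_sqr_neq0 : r2 != 0.
Proof.
pose x := (al + be) / 2; have xab : al < x < be by rewrite /x !midf_lt.
apply/eqP => r20; have := rho_ext_sqr rho_gt0 rho_q xab.
rewrite r20 horner0 => /eqP; rewrite expf_eq0 /= gt_eqF //.
exact: (rho_ext_gt0 rho_gt0 rho_q).
Qed.

Lemma size_rho_sqr : size r2 = d.+1.
Proof. by rewrite polySpred ?rho_sqr_neq0. Qed.

Lemma size_deriv_rho_sqr : (size r2^`() <= d)%N.
Proof. by have := lt_size_deriv rho_sqr_neq0; rewrite size_rho_sqr. Qed.

Lemma intx_linear2 s p c1 t1 p1 c2 t2 p2 :
  (forall x, al < x < be ->
    r x ^+ s * p.[x] = c1 * (r x ^+ t1 * p1.[x]) + c2 * (r x ^+ t2 * p2.[x])) ->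
  I s p = c1 * I t1 p1 + c2 * I t2 p2.
Proof.
have Il := intx_functional eta q lt_al_be => sp.
rewrite -(functionalZ (Il t2)) /intx /wint -Rintegral_linear //; last 2 first.
  exact: (continuous_weighted (@continuous_rho_exp _ _ _ _)).
  exact: (continuous_weighted (@continuous_rho_exp _ _ _ _)).
apply: Rintegral_eq_oo => [x /[!in_itv] /sp ->|x].
  by rewrite hornerZ; ring.
apply: cvgD; last exact: (continuous_weighted (@continuous_rho_exp _ _ _ _)).
apply: cvgM; first exact: cvg_cst.
exact: (continuous_weighted (@continuous_rho_exp _ _ _ _)).
Qed.

(** Matching powers of rho in the slope expansions leaves a u rho^i +
    b/2 v (rho^2)' rho^(i-2) with i in {0, 1, 2}. For i = 0 the second term is
    absent, and for i = 2 both are polynomials. For i = 1 the coefficients vanish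
    by parity unless rho is itself a polynomial, and then
    (rho^2)' / rho = 2 rho'. The factor rho^2 in the conclusion avoids negative
    exponents. *)
Lemma rho_shift_poly a b i (u v : {poly R}) N :
  (i = 0%N -> b = 0) -> ((2 < i)%N -> a = 0 /\ b = 0) ->
  (eta -> odd i -> a = 0 /\ b = 0) ->
  (size u <= N)%N -> (size v <= N.+1)%N ->
  exists2 X : {poly R}, ((i <= 2)%N -> (2 * size X <= 2 * N + i * d)%N) /\
      ((2 < i)%N -> X = 0) &
    forall x, al < x < be -> X.[x] * r x ^+ 2 =
      a * (u.[x] * r x ^+ i.+2) + 2^-1 * b * (v.[x] * r2^`().[x] * r x ^+ i).
Proof.
move=> b0 ab2 abo uN vN; have sr2 := size_deriv_rho_sqr.
have [ab|nab] := pselect (a = 0 /\ b = 0).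
  exists 0 => [|x _]; first by rewrite size_poly0.
  by rewrite horner0 !mul0r ab.1 ab.2 mulr0 !mul0r addr0.
case: i b0 ab2 abo => [|[|[|i]]] b0 ab2 abo.
- exists (a *: u) => [|x _].
    by split=> // _; have := size_scale_leq a u; lia.
  by rewrite hornerZ b0 // mulr0 mul0r addr0 mulrA.
- have etaF : eta = false by apply/negP => /abo -/(_ isT).
  have rE x : r x = q.[x] by rewrite /rho_ext etaF.
  have r2E : r2 = q ^+ 2 by rewrite /rho_sqr etaF.
  have q0 : q != 0 by have := rho_sqr_neq0; rewrite r2E expf_eq0.
  have dq : (d = 2 * (size q).-1)%N by rewrite /deg_rho_sqr etaF size_exp mulnC.
  have sq : (0 < size q)%N by rewrite size_poly_gt0.
  exists (a *: (u * q) + b *: (v * q^`())) => [|x _].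
    split=> // _.
    have h1 : (size (a *: (u * q)) <= (size u + size q).-1)%N.
      exact: leq_trans (size_scale_leq _ _) (size_polyMleq _ _).
    have h2 : (size (b *: (v * q^`())) <= (size v + size q^`()).-1)%N.
      exact: leq_trans (size_scale_leq _ _) (size_polyMleq _ _).
    have h3 : (size q^`() < size q)%N by exact: lt_size_deriv.
    apply: (@leq_trans (2 * (N + (size q).-1))); last by clear - dq; lia.
    rewrite leq_pmul2l //; apply: (leq_trans (size_polyD _ _)).
    rewrite geq_max (leq_trans h1) ?(leq_trans h2) //; clear - uN vN sq h3; lia.
  by rewrite rE r2E expr2 derivM !(hornerD, hornerZ, hornerM); field.
- exists (a *: (u * r2) + (2^-1 * b) *: (v * r2^`())) => [|x xab].
    split=> // _.
    have h1 : (size (a *: (u * r2)) <= (size u + size r2).-1)%N.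
      exact: leq_trans (size_scale_leq _ _) (size_polyMleq _ _).
    have h2 : (size ((2^-1 * b) *: (v * r2^`())) <= (size v + size r2^`()).-1)%N.
      exact: leq_trans (size_scale_leq _ _) (size_polyMleq _ _).
    rewrite size_rho_sqr in h1; rewrite -mulnDr leq_pmul2l //.
    apply: (leq_trans (size_polyD _ _)).
    rewrite geq_max (leq_trans h1) ?(leq_trans h2) //; clear - uN vN sr2; lia.
  rewrite hornerD !hornerZ !hornerM -(rho_ext_sqr rho_gt0 rho_q xab).
  by rewrite !exprS; ring.
- by case: nab; exact: ab2.
Qed.

(** The coefficient along a polynomial o, orthonormal for the weight
    phi^A rho^s, of the function a u rho^i + b/2 v (rho^2)' rho^(i-2),
    where t + 2 = s + i. *)
Definition rho_coef A t a b (u v o : {poly R}) : R :=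
  a * I t.+2 (phi ^+ A * (u * o)) + 2^-1 * b * I t (phi ^+ A * (v * o) * r2^`()).

(** The polynomial given by rho_shift_poly is expanded along o; the integrals that
    give its coefficients do not mention it. *)
Lemma rho_expansion A s t i a b (u v : {poly R}) N (o : nat -> {poly R}) :
  orthonormal_for (fun p => I s (phi ^+ A * p)) o -> (t.+2 = s + i)%N ->
  (i = 0%N -> b = 0) -> ((2 < i)%N -> a = 0 /\ b = 0) ->
  (eta -> odd i -> a = 0 /\ b = 0) ->
  (size u <= N)%N -> (size v <= N.+1)%N ->
  (forall m, ((i <= 2)%N -> (2 * N + i * d <= 2 * m)%N) ->
    rho_coef A t a b u v (o m) = 0) /\
  (forall M x, al < x < be -> ((i <= 2)%N -> (2 * N + i * d <= 2 * M)%N) ->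
    a * (u.[x] * r x ^+ i.+2) + 2^-1 * b * (v.[x] * r2^`().[x] * r x ^+ i) =
    r x ^+ 2 * \sum_(m < M) rho_coef A t a b u v (o m) * (o m).[x]).
Proof.
move=> oo tsi b0 ab2 abo uN vN; have Il := intx_phi_functional eta q lt_al_be s A.
have [X [sX X0] XE] := rho_shift_poly b0 ab2 abo uN vN.
have cE m : rho_coef A t a b u v (o m) = I s (phi ^+ A * (X * o m)).
  apply/esym/intx_linear2 => x xab; have r0 := rho_ext_gt0 rho_gt0 rho_q xab.
  have rn0 : r x ^+ 2 != 0 by rewrite expf_neq0 ?gt_eqF.
  apply: (mulfI rn0); rewrite !hornerM.
  transitivity ((phi ^+ A).[x] * (o m).[x] * r x ^+ s * (X.[x] * r x ^+ 2)).
    by ring.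
  rewrite XE // -(addn2 i) -[t.+2]addn2 !exprD.
  have -> : r x ^+ i = r x ^+ t * r x ^+ 2 / r x ^+ s.
    by rewrite -exprD addn2 tsi exprD mulrC mulKf // expf_neq0 ?gt_eqF.
  by field; rewrite expf_neq0 // gt_eqF.
have sXm m : ((i <= 2)%N -> (2 * N + i * d <= 2 * m)%N) -> (size X <= m)%N.
  move=> h; have [i2|i2] := leqP i 2; last by rewrite X0 ?size_poly0.
  by have := sX i2; have := h i2; lia.
split=> [m /sXm|M x xab /sXm] Xm; first by rewrite cE (orthonormal_low Il oo).
rewrite -XE // mulrC; congr (_ * _).
rewrite {1}(orthonormal_expansion Il oo Xm) horner_sum; apply: eq_bigr => m _.
by rewrite hornerZ cE.
Qed.

(** The coefficient of index (m', k') of the x-derivative of the function of index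
    (m, k); coefx_adj is the coefficient of index (m, k) of the x-derivative of
    the weighted function of index (m', k'). *)
Definition coefx A C m' k' m k : R :=
  rho_coef A.+1 (k + k' + 2 * C + 1) (coefy ga de C k' k) (coefy_euler ga de C k' k)
    (Rx A C k m)^`() (Rx A C k m) (Rx A.+1 C.+1 k' m').

Definition coefx_adj A C m' k' m k : R :=
  rho_coef A (k + k' + 2 * C + 1) (coefy ga de C k' k) (coefy_euler' ga de C k' k)
    (deriv_quot phi A (Rx A.+1 C.+1 k' m')) (phi * Rx A.+1 C.+1 k' m') (Rx A C k m).

Hypothesis lt_ga_de : ga < de.

(** Integration by parts in both variables: coefy_eulerD adds up the coefficients
    in the slope, and what remains is a multiple of the integral of the
    derivative of phi^(A+1) rho^(S+2) g f, with S = k + k' + 2 C + 1 and f, g the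
    two polynomials in x. Hence W_x is minus the transpose of D_x. *)
Lemma coefx_adjE A C m' k' m k : coefx_adj A C m' k' m k = - coefx A C m' k' m k.
Proof.
apply/eqP; rewrite -addr_eq0; apply/eqP; rewrite /coefx_adj /coefx /rho_coef.
set f := Rx A C k m; set g := Rx A.+1 C.+1 k' m'.
pose p := phi ^+ A.+1 * g * f.
have [pa pb] : p.[al] = 0 /\ p.[be] = 0.
  by rewrite /p !hornerM !horner_exp !edgeE !subrr mulr0 mul0r expr0n /= !mul0r.
have := intx_by_parts lt_al_be rho_gt0 rho_q (k + k' + 2 * C + 1) pa pb.
have Il s := intx_functional eta q lt_al_be s.
have -> : p^`() = phi ^+ A * (deriv_quot phi A g * f) + phi ^+ A.+1 * (f^`() * g).
  by rewrite /p derivM deriv_quotE -!mulrA (mulrC g).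
rewrite (functionalD (Il _)).
have -> : phi ^+ A * (phi * g * f) * r2^`() = p * r2^`().
  by rewrite /p exprSr !mulrA.
have -> : phi ^+ A.+1 * (f * g) * r2^`() = p * r2^`().
  by rewrite /p (mulrC f) !mulrA.
have := coefy_eulerD lt_ga_de C k' k.
rewrite (_ : k + k' + 2 * C + 3 = (k + k' + 2 * C + 1).+2)%N; last by lia.
move: (coefy _ _ _ _ _) (coefy_euler _ _ _ _ _) (coefy_euler' _ _ _ _ _).
move: (I _ _) (I _ _) (I _ _) (_.+2%:R) => i1 i2 i3 n a b b' bb ii.
have -> : b' = n * a - b by rewrite -bb; ring.
have -> : i3 = - (i2 + n / 2 * i1) by apply/eqP; rewrite -addr_eq0 addrA ii.
by field.
Qed.

End AbscissaCoefficients.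

(** * The six elementary matrices *)

Section ElementaryMatrices.
Variables (R : realType) (al be ga de : R) (rho : R -> R) (eta : bool) (q : {poly R}).
Hypotheses (lt_al_be : al < be) (lt_ga_de : ga < de).
Hypothesis rho_gt0 : forall x, al < x < be -> 0 < rho x.
Hypothesis rho_q : rho_case al be ga de rho eta q.

Local Notation r := (rho_ext eta q).
Local Notation r2 := (rho_sqr eta q).
Local Notation I := (intx al be eta q).
Local Notation Y := (inty ga de).
Local Notation phi := (edge al be).
Local Notation om := (edge ga de).
Local Notation Rx := (polyx al be rho).
Local Notation P := (polyy ga de).
Local Notation d := (deg_rho_sqr eta q).
Local Notation Om := ((Omega al be ga de rho)°).
Local Notation mux := (coefx al be ga de rho eta q).
Local Notation nux := (coefx_adj al be ga de rho eta q).
Local Notation ay := (coefy ga de).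
Local Notation ey := (coefy_euler ga de).
Local Notation ey' := (coefy_euler' ga de).
Local Notation dy := (coefy_deriv ga de).

(** Indexed by the degree m = n - k of the factor in x and the degree k in the
    slope. *)
Definition hfun A C m k : R -> R -> R := sep rho (Rx A C k m) k (P C k).

Definition wfun A C m k : R -> R -> R :=
  sep rho (phi ^+ A * Rx A C k m) (2 * C + k) (om ^+ C * P C k).

Lemma H_hfun A C n (k : 'I_n.+1) x y :
  H al be ga de rho A%:R A%:R C%:R C%:R k x y = hfun A C (n - k) k x y.
Proof. by []. Qed.

(** The factor (y - ga rho)(de rho - y) of the weight is rho^2 om(y / rho). *)
Lemma W_wfun A C n (k : 'I_n.+1) (x y : R) : Om (x, y) ->
  W al be ga de rho A%:R A%:R C%:R C%:R k x y = wfun A C (n - k) k x y.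
Proof.
move=> /(interior_OmegaE rho_q)[xab /andP[gy yd]].
have r0 := rho_gt0 xab; have /andP[ax xb] := xab.
rewrite /W H_hfun /weight !powR_mulrn ?subr_ge0 ?ltW // /wfun /hfun /sep.
have e : (y - ga * rho x) ^+ C * (de * rho x - y) ^+ C =
    rho x ^+ 2 ^+ C * ((de - y / rho x) * (y / rho x - ga)) ^+ C.
  by rewrite -!exprMn; congr (_ ^+ C); field; rewrite gt_eqF.
rewrite -[X in X * _]mulrA e !hornerM !horner_exp !edgeE exprD exprM.
by rewrite [((be - x) * _) ^+ A]exprMn; ring.
Qed.

Section CoefxSupport.
Variables (A C : nat).

(** The polynomial in x that multiplies rho^k' P_k' in the x-derivative of the
    function of index (m, k). *)
Lemma coefx_expansion m k' k : (k' <= k)%N ->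
  (forall m', ((k - k' <= 2)%N -> (2 * m + (k - k') * d <= 2 * m')%N) ->
    mux A C m' k' m k = 0) /\
  (forall M x, al < x < be ->
    ((k - k' <= 2)%N -> (2 * m + (k - k') * d <= 2 * M)%N) ->
    ay C k' k * ((Rx A C k m)^`().[x] * r x ^+ (k - k').+2) +
    2^-1 * ey C k' k *
      ((Rx A C k m).[x] * r2^`().[x] * r x ^+ (k - k')) =
    r x ^+ 2 * \sum_(m' < M) mux A C m' k' m k * (Rx A.+1 C.+1 k' m').[x]).
Proof.
move=> kk; rewrite /coefx.
apply: (rho_expansion lt_al_be rho_gt0 rho_q
  (polyx_orthonormal lt_al_be rho_gt0 rho_q A.+1 C.+1 k')).
- by lia.
- by move=> i0; apply: coefy_euler_eq0 => //; lia.
- by move=> i2; split; [apply: coefy_eq0|apply: coefy_euler_eq0] => //; lia.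
- move=> et od; apply: (coefy_odd lt_ga_de rho_q C et).
  by rewrite oddD; rewrite oddB // in od.
- have R0 : Rx A C k m != 0.
    by rewrite -size_poly_gt0 (size_polyx lt_al_be rho_gt0 rho_q).
  by have := lt_size_deriv R0; rewrite (size_polyx lt_al_be rho_gt0 rho_q).
- by rewrite (size_polyx lt_al_be rho_gt0 rho_q).
Qed.

Lemma coefx_adj_expansion m' k' k : (k <= k' + 2)%N ->
  (forall m, ((k' + 2 - k <= 2)%N -> (2 * (m' + 2) + (k' + 2 - k) * d <= 2 * m)%N) ->
    nux A C m' k' m k = 0) /\
  (forall M x, al < x < be ->
    ((k' + 2 - k <= 2)%N -> (2 * (m' + 2) + (k' + 2 - k) * d <= 2 * M)%N) ->
    ay C k' k * ((deriv_quot phi A (Rx A.+1 C.+1 k' m')).[x] *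
                    r x ^+ (k' + 2 - k).+2) +
    2^-1 * ey' C k' k *
      ((phi * Rx A.+1 C.+1 k' m').[x] * r2^`().[x] * r x ^+ (k' + 2 - k)) =
    r x ^+ 2 * \sum_(m < M) nux A C m' k' m k * (Rx A C k m).[x]).
Proof.
move=> kk; rewrite /coefx_adj.
apply: (rho_expansion lt_al_be rho_gt0 rho_q
  (polyx_orthonormal lt_al_be rho_gt0 rho_q A C k)).
- by lia.
- by move=> i0; apply: coefy_euler'_eq0 => //; lia.
- by move=> i2; split; [apply: coefy_eq0|apply: coefy_euler'_eq0] => //; lia.
- move=> et od; have okk : odd (k + k').
    by rewrite oddB // !oddD addbF in od; rewrite oddD addbC.
  have [-> _] := coefy_odd lt_ga_de rho_q C et okk.
  by rewrite (coefy_euler'_odd lt_ga_de rho_q).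
- apply: (leq_trans (size_deriv_quot _ _ _ _)).
  by rewrite (size_polyx lt_al_be rho_gt0 rho_q) addn2.
- apply: (leq_trans (size_polyMleq _ _)).
  by rewrite size_edge (size_polyx lt_al_be rho_gt0 rho_q); lia.
Qed.

(** The bound on m' comes from the degree of the x-derivative, that on m from
    the degree of the adjoint, by coefx_adjE. *)
Lemma coefx_support m' k' m k : mux A C m' k' m k != 0 ->
  [/\ (k' <= k)%N, (k <= k' + 2)%N, (2 * m' < 2 * m + (k - k') * d)%N &
      (2 * m < 2 * (m' + 2) + (k' + 2 - k) * d)%N].
Proof.
move=> c0; have kk : (k' <= k <= k' + 2)%N.
  apply/contraT => kk; move: c0; rewrite /coefx /rho_coef.
  rewrite coefy_eq0 // coefy_euler_eq0 ?mulr0 ?mul0r ?addr0 ?eqxx //.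
  by apply: contra kk => /andP[/ltnW -> ->].
have /andP[kk1 kk2] := kk; split=> //; rewrite ltnNge; apply: contraNN c0 => h.
  by apply/eqP; have [-> //] := coefx_expansion m kk1.
have [z _] := coefx_adj_expansion m' kk2; apply/eqP.
have := z m (fun=> h); rewrite coefx_adjE // => /eqP.
by rewrite oppr_eq0 => /eqP.
Qed.

End CoefxSupport.



Lemma polyy_expansion C n (g : {poly R}) t : (size g <= n)%N ->
  g.[t] = \sum_(k < n) Y (om ^+ C * (g * P C k)) * (P C k).[t].
Proof.
move=> gn; rewrite {1}(orthonormal_expansion (inty_om_functional lt_ga_de C)
  (polyy_orthonormal lt_ga_de C) gn) horner_sum.
by apply: eq_bigr => k _; rewrite hornerZ.
Qed.

Hypothesis deg_q : (2 + eta <= (size q).-1)%N.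

Lemma deg_rho_sqr_ge3 : (3 <= d)%N.
Proof.
move: deg_q; rewrite /deg_rho_sqr; case: eta => //= h.
by rewrite size_exp; move: h; set n := _.-1; clear; lia.
Qed.

Lemma partial_x_hfun A C m k (x y : R) : Om (x, y) ->
  partial_x (hfun A C m k) x y =
  \sum_(k' < (m + k + (d - 3)).+1) \sum_(m' < (m + k + (d - 3)).+1)
    hfun A.+1 C.+1 m' k' x y * mux A C m' k' m k.
Proof.
move=> /(interior_OmegaE rho_q)[xab _]; have d3 := deg_rho_sqr_ge3.
rewrite /partial_x derive1E /hfun.
have [_ ->] := is_derive_sep_x rho_gt0 rho_q (Rx A C k m) k (P C k) y xab.
set N := (m + k + (d - 3)).+1; set t := y / rho x.
have kN : (k < N)%N by rewrite /N; lia.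
rewrite (@polyy_expansion C.+1 N (P C k)) ?size_polyy //.
rewrite (@polyy_expansion C.+1 N (euler k (P C k))); last first.
  by apply: (leq_trans (size_euler _)); [rewrite size_polyy|exact: ltnW].
have rE := rho_extE rho_q xab; have r0 := rho_gt0 xab.
rewrite !mulr_sumr -big_split /=; apply: eq_bigr => k' _.
rewrite [X in om ^+ C.+1 * X]mulrC -/(ay C k' k).
rewrite [X in om ^+ C.+1 * X]mulrC -/(ey C k' k) /sep -/t.
transitivity (rho x ^+ k' * (P C.+1 k').[t] *
    \sum_(m' < N) mux A C m' k' m k * (Rx A.+1 C.+1 k' m').[x]); last first.
  by rewrite mulr_sumr; apply: eq_bigr => m' _; ring.
have [kk|kk] := leqP k' k; last first.
  rewrite (coefy_eq0 lt_ga_de) ?(coefy_euler_eq0 lt_ga_de) -?leqNgt //;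
    try by rewrite negb_and -!ltnNge; lia.
  rewrite !mul0r !mulr0 addr0 big1 ?mulr0 // => m' _.
  apply/eqP; rewrite mulf_eq0; apply/orP; left; apply/contraT => /coefx_support[].
  by rewrite leqNgt kk.
have [_ /(_ N x xab)] := coefx_expansion A C m kk.
rewrite -rE => E.
have {}E := E _; have rn0 : rho x ^+ 2 != 0 by rewrite expf_neq0 // gt_eqF.
apply: (mulfI rn0); rewrite [RHS]mulrCA.
rewrite -E; last first.
  have : (k - k' <= k)%N by exact: leq_subr.
  by move: (k - k')%N => [|[|[|i]]]; rewrite /N; lia.
have -> : rho x ^+ k = rho x ^+ k' * rho x ^+ (k - k') by rewrite -exprD subnKC.
by rewrite !exprS; field; rewrite gt_eqF.
Qed.

Lemma partial_x_wfun A C m' k' (x y : R) : Om (x, y) ->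
  partial_x (wfun A.+1 C.+1 m' k') x y =
  \sum_(k < (m' + k' + (d + 1)).+1) \sum_(m < (m' + k' + (d + 1)).+1)
    wfun A C m k x y * - mux A C m' k' m k.
Proof.
move=> /(interior_OmegaE rho_q)[xab _]; have d3 := deg_rho_sqr_ge3.
rewrite /partial_x derive1E /wfun.
have [_ ->] := is_derive_sep_x rho_gt0 rho_q (phi ^+ A.+1 * Rx A.+1 C.+1 k' m')
  (2 * C.+1 + k') (om ^+ C.+1 * P C.+1 k') y xab.
set N := (m' + k' + (d + 1)).+1; set t := y / rho x.
have kN : (k' + 2 < N)%N by rewrite /N; lia.
have -> : (2 * C.+1 + k' = 2 * C + 2 + k')%N by lia.
have -> : om ^+ C.+1 * P C.+1 k' = om ^+ C * (om * P C.+1 k').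
  by rewrite exprSr mulrA.
have -> : euler (2 * C + 2 + k') (om ^+ C * (om * P C.+1 k')) =
    om ^+ C * euler_quot ga de C (2 * C + 2 + k') (P C.+1 k').
  by rewrite -euler_quotE exprSr mulrA.
have -> : phi ^+ A.+1 * Rx A.+1 C.+1 k' m' = phi ^+ A * (phi * Rx A.+1 C.+1 k' m').
  by rewrite exprSr mulrA.
rewrite (_ : (phi ^+ A * _)^`() = phi ^+ A * deriv_quot phi A (Rx A.+1 C.+1 k' m')); last first.
  by rewrite -deriv_quotE exprSr mulrA.
rewrite !(hornerM (om ^+ C)) !(hornerM (phi ^+ A)).
rewrite (@polyy_expansion C N (om * P C.+1 k')); last first.
  apply: (leq_trans (size_polyMleq _ _)); rewrite size_edge size_polyy //.
  by move: kN; clear; lia.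
rewrite (@polyy_expansion C N (euler_quot _ _ _ _ _)); last first.
  apply: leq_trans (ltnW kN); apply: (size_euler_quot lt_ga_de).
  by rewrite size_polyy.
have rE := rho_extE rho_q xab; have r0 := rho_gt0 xab.
rewrite !mulr_sumr -big_split /=; apply: eq_bigr => k _.
have -> : Y (om ^+ C * (om * P C.+1 k' * P C k)) = ay C k' k.
  by rewrite /coefy exprSr -!mulrA.
have -> : Y (om ^+ C * (euler_quot ga de C (2 * C + 2 + k') (P C.+1 k') * P C k)) = ey' C k' k.
  by rewrite /coefy_euler' euler_quotE -!mulrA.
transitivity (rho x ^+ (2 * C + k) * ((phi ^+ A).[x] * (om ^+ C).[t] * (P C k).[t]) *
    \sum_(m < N) nux A C m' k' m k * (Rx A C k m).[x]); last first.
  rewrite mulr_sumr; apply: eq_bigr => m _.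
  by rewrite coefx_adjE // /sep -/t !hornerM; ring.
have [kk|kk] := leqP k (k' + 2); last first.
  rewrite (coefy_eq0 lt_ga_de) ?(coefy_euler'_eq0 lt_ga_de);
    try by rewrite negb_and -!ltnNge; lia.
  rewrite !mul0r !mulr0 addr0 big1 ?mulr0 // => m _.
  rewrite coefx_adjE //; apply/eqP; rewrite mulf_eq0 oppr_eq0; apply/orP; left.
  by apply/contraT => /coefx_support[_]; rewrite leqNgt kk.
have [_ /(_ N x xab)] := coefx_adj_expansion A C m' kk.
rewrite -rE => E.
have {}E := E _; have rn0 : rho x ^+ 2 != 0 by rewrite expf_neq0 // gt_eqF.
apply: (mulfI rn0); rewrite [RHS]mulrCA.
rewrite -E; last first.
  have : (k' + 2 - k <= k' + 2)%N by exact: leq_subr.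
  by move: (k' + 2 - k)%N => [|[|[|i]]]; rewrite /N; lia.
have -> : rho x ^+ (2 * C + 2 + k') = rho x ^+ (2 * C + k) * rho x ^+ (k' + 2 - k).
  by rewrite -exprD; congr (_ ^+ _); lia.
by rewrite !exprS; field; rewrite gt_eqF.
Qed.


Definition coeft A C (m' k' m k : nat) : R :=
  (k' == k)%:R * I (2 * (C + k) + 1) (phi ^+ A.+1 * (Rx A C k m * Rx A.+1 C k m')).

(** The bound on m' is the degree of R_m; after the factor phi, of degree 2, has
    been moved, the bound on m is that of phi R_m'. *)
Lemma coeft_support A C m' k' m k : coeft A C m' k' m k != 0 ->
  [/\ k' = k, (m' <= m)%N & (m <= m' + 2)%N].
Proof.
rewrite /coeft; have [->|] := eqVneq k' k; last by rewrite mul0r eqxx.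
rewrite mul1r => c0; split=> //; rewrite leqNgt; apply: contraNN c0 => mm; apply/eqP.
  apply: (orthonormal_low (intx_phi_functional eta q lt_al_be _ A.+1)
    (polyx_orthonormal lt_al_be rho_gt0 rho_q A.+1 C k)).
  by rewrite (size_polyx lt_al_be rho_gt0 rho_q).
rewrite exprSr -mulrA (mulrC (Rx A C k m)) (mulrA phi).
apply: (orthonormal_low (intx_phi_functional eta q lt_al_be _ A)
  (polyx_orthonormal lt_al_be rho_gt0 rho_q A C k)).
apply: (leq_trans (size_polyMleq _ _)).
rewrite size_edge (size_polyx lt_al_be rho_gt0 rho_q).
by move: mm; clear; lia.
Qed.

Lemma polyx_expansion A C k n (g : {poly R}) x : (size g <= n)%N ->
  g.[x] = \sum_(m < n) I (2 * (C + k) + 1) (phi ^+ A * (g * Rx A C k m)) *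
    (Rx A C k m).[x].
Proof.
move=> gn; rewrite {1}(orthonormal_expansion (intx_phi_functional eta q lt_al_be _ A)
  (polyx_orthonormal lt_al_be rho_gt0 rho_q A C k) gn) horner_sum.
by apply: eq_bigr => m _; rewrite hornerZ.
Qed.

Lemma hfun_coeft A C m k (x y : R) :
  hfun A C m k x y =
  \sum_(k' < (m + k + 0).+1) \sum_(m' < (m + k + 0).+1)
    hfun A.+1 C m' k' x y * coeft A C m' k' m k.
Proof.
have kN : (k < (m + k + 0).+1)%N by clear; lia.
rewrite (bigD1 (Ordinal kN)) //= [X in _ + X]big1 ?addr0 => [|k' kk']; last first.
  rewrite -val_eqE /= in kk'; rewrite big1 // => m' _.
  by rewrite /coeft (negPf kk') mul0r mulr0.
rewrite {1}/hfun /sep (@polyx_expansion A.+1 C k (m + k + 0).+1); last first.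
  by rewrite (size_polyx lt_al_be rho_gt0 rho_q); clear; lia.
rewrite !mulr_suml; apply: eq_bigr => m' _.
by rewrite /coeft eqxx mul1r /hfun /sep; ring.
Qed.

Lemma wfun_coeft A C m' k' (x y : R) :
  wfun A.+1 C m' k' x y =
  \sum_(k < (m' + k' + 2).+1) \sum_(m < (m' + k' + 2).+1)
    wfun A C m k x y * coeft A C m' k' m k.
Proof.
have kN : (k' < (m' + k' + 2).+1)%N by clear; lia.
rewrite (bigD1 (Ordinal kN)) //= [X in _ + X]big1 ?addr0 => [|k kk']; last first.
  rewrite -val_eqE /= eq_sym in kk'; rewrite big1 // => m _.
  by rewrite /coeft (negPf kk') mul0r mulr0.
rewrite {1}/wfun /sep.
have -> : phi ^+ A.+1 * Rx A.+1 C k' m' = phi ^+ A * (phi * Rx A.+1 C k' m').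
  by rewrite exprSr mulrA.
rewrite (hornerM (phi ^+ A)).
rewrite (@polyx_expansion A C k' (m' + k' + 2).+1 (phi * _)); last first.
  apply: (leq_trans (size_polyMleq _ _)); rewrite size_edge.
  by rewrite (size_polyx lt_al_be rho_gt0 rho_q); clear; lia.
rewrite mulr_sumr !mulr_suml; apply: eq_bigr => m _.
rewrite /coeft eqxx mul1r /wfun /sep !(hornerM (phi ^+ A)) exprSr.
by rewrite -(mulrA (phi ^+ A)) (mulrC (Rx A C k' m)) (mulrA phi); ring.
Qed.

Definition coefdy C (m' k' m k : nat) : R := ((k == k'.+1) && (m' == m))%:R * dy C k' k.

Lemma coefdy_support C m' k' m k : coefdy C m' k' m k != 0 -> k = k'.+1 /\ m' = m.
Proof.
rewrite /coefdy; have [->|] := eqVneq k k'.+1; last by rewrite mul0r eqxx.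
by have [->|] := eqVneq m' m; rewrite ?mul0r ?eqxx.
Qed.

Lemma partial_y_hfun A C m k (x y : R) : Om (x, y) ->
  partial_y (hfun A C m k) x y =
  \sum_(k' < (m + k + 0).+1) \sum_(m' < (m + k + 0).+1)
    hfun A C.+1 m' k' x y * coefdy C m' k' m k.
Proof.
move=> /(interior_OmegaE rho_q)[xab _]; have r0 := rho_gt0 xab.
rewrite /partial_y derive1E /hfun; have [_ ->] := is_derive_sep_y rho (Rx A C k m) k (P C k) x y.
rewrite (@polyy_expansion C.+1 (m + k + 0).+1 (P C k)^`()); last first.
  have P0 : P C k != 0 by rewrite -size_poly_gt0 size_polyy.
  apply: (@leq_trans k); last by clear; lia.
  by have := lt_size_deriv P0; rewrite size_polyy.
rewrite mulr_sumr; apply: eq_bigr => k' _.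
rewrite [X in om ^+ C.+1 * X]mulrC -/(dy C k' k).
have [kk|kk] := eqVneq k k'.+1; last first.
  rewrite (coefy_deriv_eq0 lt_ga_de) // mul0r mulr0 big1 // => m' _.
  by rewrite /coefdy (negPf kk) mul0r mulr0.
have mN : (m < (m + k + 0).+1)%N by clear; lia.
rewrite (bigD1 (Ordinal mN)) //= big1 ?addr0 => [|m' mm]; last first.
  by rewrite -val_eqE /= in mm; rewrite /coefdy (negPf mm) andbF mul0r mulr0.
move: (nat_of_ord k') kk => {}k' ->.
rewrite /coefdy !eqxx mul1r /sep polyx_shift // exprS; field.
by rewrite gt_eqF.
Qed.

Lemma partial_y_wfun A C m' k' (x y : R) : Om (x, y) ->
  partial_y (wfun A C.+1 m' k') x y =
  \sum_(k < (m' + k' + 1).+1) \sum_(m < (m' + k' + 1).+1)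
    wfun A C m k x y * - coefdy C m' k' m k.
Proof.
move=> /(interior_OmegaE rho_q)[xab _]; have r0 := rho_gt0 xab.
rewrite /partial_y derive1E /wfun.
have [_ ->] := is_derive_sep_y rho (phi ^+ A * Rx A C.+1 k' m') (2 * C.+1 + k')
  (om ^+ C.+1 * P C.+1 k') x y.
rewrite deriv_quotE (hornerM (om ^+ C)).
rewrite (@polyy_expansion C (m' + k' + 1).+1 (deriv_quot _ _ _)); last first.
  apply: (leq_trans (size_deriv_quot _ _ _ _)); rewrite size_polyy //.
  by clear; lia.
rewrite !mulr_sumr; apply: eq_bigr => k _; rewrite coefy_derivN //.
have [kk|kk] := eqVneq (k : nat) k'.+1; last first.
  rewrite (coefy_deriv_eq0 lt_ga_de) // oppr0 mul0r !mulr0 big1 // => m _.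
  by rewrite /coefdy (negPf kk) mul0r oppr0 mulr0.
have mN : (m' < (m' + k' + 1).+1)%N by clear; lia.
rewrite (bigD1 (Ordinal mN)) //= [X in _ + X]big1 ?addr0 => [|m mm]; last first.
  rewrite -val_eqE /= eq_sym in mm.
  by rewrite /coefdy (negPf mm) andbF mul0r oppr0 mulr0.
move: (nat_of_ord k) kk => {}k ->.
rewrite /coefdy !eqxx mul1r /sep polyx_shift // !(hornerM (om ^+ C)).
have -> : (2 * C.+1 + k' = (2 * C + k'.+1).+1)%N by clear; lia.
by rewrite exprS; field; rewrite gt_eqF.
Qed.

End ElementaryMatrices.

(** * Representations and bandwidths *)

Section Representations.
Variables (R : realType) (al be ga de : R) (rho : R -> R) (eta : bool) (q : {poly R}).
Hypotheses (lt_al_be : al < be) (lt_ga_de : ga < de).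
Hypothesis rho_gt0 : forall x, al < x < be -> 0 < rho x.
Hypothesis rho_q : rho_case al be ga de rho eta q.
Hypothesis deg_q : (2 + eta <= (size q).-1)%N.

Local Notation phi := (edge al be).
Local Notation om := (edge ga de).
Local Notation Rx := (polyx al be rho).
Local Notation P := (polyy ga de).
Local Notation d := (deg_rho_sqr eta q).
Local Notation Om := ((Omega al be ga de rho)°).
Local Notation mux := (coefx al be ga de rho eta q).
Local Notation hf := (hfun al be ga de rho).
Local Notation wf := (wfun al be ga de rho).
Local Notation mut := (coeft al be rho eta q).
Local Notation mudy := (coefdy ga de).
Local Notation HN A C := (H al be ga de rho A%:R A%:R C%:R C%:R).
Local Notation WN A C := (W al be ga de rho A%:R A%:R C%:R C%:R).

Lemma open_Om : open Om.
Proof. exact: open_interior. Qed.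

Lemma W_H00 : WN 0 0 = HN 0 0 :> frow R.
Proof.
apply: functional_extensionality_dep => n; apply/funext => k.
by apply/funext => x; apply/funext => y; rewrite /W /weight !powRr0 !mul1r.
Qed.

Lemma partial_x_eq (f g : R -> R -> R) (x y : R) :
  (forall x y, Om (x, y) -> f x y = g x y) -> Om (x, y) ->
  partial_x f x y = partial_x g x y.
Proof.
move=> fg Oxy; rewrite /partial_x !derive1E; apply: near_eq_derive.
by apply: filterS (open_near_x open_Om Oxy) => t; exact: fg.
Qed.

Lemma partial_y_eq (f g : R -> R -> R) (x y : R) :
  (forall x y, Om (x, y) -> f x y = g x y) -> Om (x, y) ->
  partial_y f x y = partial_y g x y.
Proof.
move=> fg Oxy; rewrite /partial_y !derive1E; apply: near_eq_derive.
by apply: filterS (open_near_y open_Om Oxy) => t; exact: fg.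
Qed.

Lemma derivable_x_H A C : derivable_x Om (HN A C).
Proof.
move=> n k x y /(interior_OmegaE rho_q)[xab _].
by have [] := is_derive_sep_x rho_gt0 rho_q (Rx A C k (n - k)) k (P C k) y xab.
Qed.

Lemma derivable_y_H A C : derivable_y Om (HN A C).
Proof.
move=> n k x y _.
by have [] := is_derive_sep_y rho (Rx A C k (n - k)) k (P C k) x y.
Qed.

Lemma derivable_x_W A C : derivable_x Om (WN A C).
Proof.
move=> n k x y Oxy; have [xab _] := (interior_OmegaE rho_q _ _).1 Oxy.
have [dw _] := is_derive_sep_x rho_gt0 rho_q (phi ^+ A * Rx A C k (n - k))
  (2 * C + k) (om ^+ C * P C k) y xab.
apply: near_eq_derivable dw.
apply: filterS (open_near_x open_Om Oxy) => t Ot; apply/esym.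
exact: (W_wfun rho_gt0 rho_q).
Qed.

Lemma derivable_y_W A C : derivable_y Om (WN A C).
Proof.
move=> n k x y Oxy.
have [dw _] := is_derive_sep_y rho (phi ^+ A * Rx A C k (n - k))
  (2 * C + k) (om ^+ C * P C k) x y.
apply: near_eq_derivable dw.
apply: filterS (open_near_y open_Om Oxy) => t Ot; apply/esym.
exact: (W_wfun rho_gt0 rho_q).
Qed.

(** For fixed x a relation holds between the P_k, so all its coefficients, which
    are combinations of the R_m, vanish. *)
Lemma hfun_free A C (c : nat -> nat -> R) N :
  (forall x y, Om (x, y) -> \sum_(k < N) \sum_(m < N) hf A C m k x y * c m k = 0) ->
  forall m k, (m < N)%N -> (k < N)%N -> c m k = 0.
Proof.
move=> c0 m k mN kN.
have slope x : al < x < be ->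
    \sum_(m < N) (Rx A C k m).[x] * c m k = 0.
  move=> xab; have r0 := rho_gt0 xab.
  pose b k := (\sum_(m < N) (Rx A C k m).[x] * c m k) * rho x ^+ k.
  suff /eqP : b k = 0.
    by rewrite mulf_eq0 expf_eq0 (gt_eqF r0) andbF orbF => /eqP.
  apply: (orthonormal_free (inty_om_functional lt_ga_de C)
    (polyy_orthonormal lt_ga_de C) (N := N)) => //.
  apply: (poly_eq0_itv lt_ga_de) => t /andP[gt td].
  rewrite -[RHS](c0 x (t * rho x)); last first.
    by apply/(interior_OmegaE rho_q); split=> //; rewrite !ltr_pM2r ?gt ?td.
  rewrite horner_sum; apply: eq_bigr => j _; rewrite hornerZ /b !mulr_suml.
  by apply: eq_bigr => i _; rewrite /hfun /sep mulfK ?gt_eqF //; ring.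
apply: (orthonormal_free (intx_phi_functional eta q lt_al_be _ A)
  (polyx_orthonormal lt_al_be rho_gt0 rho_q A C k) (N := N) (c := c^~ k)) => //.
apply: (poly_eq0_itv lt_al_be) => x xab; rewrite -[RHS](slope x xab) horner_sum.
by apply: eq_bigr => i _; rewrite hornerZ mulrC.
Qed.

Lemma independent_H A C : independent Om (HN A C).
Proof.
apply: (independent_indexed (g := hf A C)) => // c N.
exact: hfun_free.
Qed.

Lemma independent_W A C : independent Om (WN A C).
Proof.
apply: (independent_indexed (g := wf A C)) => [n k x y|c N c0].
  exact: (W_wfun rho_gt0 rho_q).
apply: (@hfun_free A C) => x y Oxy.
have [xab yab] := (interior_OmegaE rho_q _ _).1 Oxy; have r0 := rho_gt0 xab.
pose w := (phi ^+ A).[x] * rho x ^+ (2 * C) * (om ^+ C).[y / rho x].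
have w0 : w != 0.
  rewrite !mulf_neq0 ?expf_neq0 ?gt_eqF // horner_exp exprn_gt0 //.
    exact: edge_gt0.
  by apply: edge_gt0; rewrite ltr_pdivlMr // ltr_pdivrMr.
apply: (mulfI w0); rewrite mulr0 -[RHS](c0 x y Oxy) mulr_sumr.
apply: eq_bigr => k _; rewrite mulr_sumr; apply: eq_bigr => m _.
by rewrite /w /hfun /wfun /sep !hornerM exprD; ring.
Qed.

(** Put j = k - k', so 0 <= j <= 2. The bounds of coefx_support read
    2 (m' + k') < 2 (m + k) + j (d - 2) and
    2 (m + k) < 2 (m' + k') + 8 + (2 - j) (d - 2); as d >= 3 the worst cases are
    j = 2 and j = 0. *)
Lemma coefx_band A C m' k' m k : mux A C m' k' m k != 0 ->
  [/\ (m' + k' <= m + k + (d - 3))%N, (m + k <= m' + k' + (d + 1))%N,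
      (k' <= k + 0)%N & (k <= k' + 2)%N].
Proof.
have d3 := deg_rho_sqr_ge3 deg_q.
move=> /(coefx_support lt_al_be lt_ga_de rho_gt0 rho_q)[kk kk2 + +].
move: (k - k')%N (subnKC kk) kk2 => j <-.
rewrite leq_add2l subnDl; move: d3; clear.
case: j => [|[|[|j]]] d3 j2 h1 h2; move: d3 j2 h1 h2; clear;
  by move=> *; split; lia.
Qed.

Lemma represents_Dx A C :
  represents Om (frow_map partial_x (HN A C)) (HN A.+1 C.+1) (bmx_of (mux A C)).
Proof.
apply: (@represents_bmx_of _ _ _ _ (fun m k => partial_x (hf A C m k))
  (hf A.+1 C.+1) _ (d - 3)) => //.
  by move=> m' k' m k /coefx_band[].
move=> m k x y Oxy.
exact: (partial_x_hfun lt_al_be lt_ga_de rho_gt0 rho_q deg_q).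
Qed.

Lemma represents_Wx A C :
  represents Om (frow_map partial_x (WN A.+1 C.+1)) (WN A C)
    (bmx_of (fun m k m' k' => - mux A C m' k' m k)).
Proof.
apply: (@represents_bmx_of _ _ _ _ (fun m k => partial_x (wf A.+1 C.+1 m k))
  (wf A C) _ (d + 1)).
- move=> n k x y Oxy; apply: partial_x_eq => // {Oxy}x {}y.
  exact: (W_wfun rho_gt0 rho_q).
- by move=> n k x y; exact: (W_wfun rho_gt0 rho_q).
- by move=> m' k' m k; rewrite oppr_eq0 => /coefx_band[].
move=> m k x y Oxy.
exact: (partial_x_wfun lt_al_be lt_ga_de rho_gt0 rho_q deg_q).
Qed.

Lemma coeft_band A C m' k' m k : mut A C m' k' m k != 0 ->
  [/\ (m' + k' <= m + k + 0)%N, (m + k <= m' + k' + 2)%N,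
      (k' <= k + 0)%N & (k <= k' + 0)%N].
Proof.
move=> /(coeft_support lt_al_be rho_gt0 rho_q)[-> m1 m2].
by move: m1 m2; clear; split; lia.
Qed.

Lemma represents_T A C :
  represents Om (HN A C) (HN A.+1 C) (bmx_of (mut A C)).
Proof.
apply: (@represents_bmx_of _ _ _ _ (hf A C) (hf A.+1 C) _ 0) => //.
  by move=> m' k' m k /coeft_band[].
by move=> m k x y _; exact: (hfun_coeft lt_al_be rho_gt0 rho_q).
Qed.

Lemma represents_TW A C :
  represents Om (WN A.+1 C) (WN A C) (bmx_of (fun m k m' k' => mut A C m' k' m k)).
Proof.
apply: (@represents_bmx_of _ _ _ _ (wf A.+1 C) (wf A C) _ 2).
- by move=> n k x y; exact: (W_wfun rho_gt0 rho_q).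
- by move=> n k x y; exact: (W_wfun rho_gt0 rho_q).
- by move=> m' k' m k /coeft_band[].
by move=> m k x y _; exact: (wfun_coeft lt_al_be rho_gt0 rho_q).
Qed.

Lemma coefdy_band C m' k' m k : mudy C m' k' m k != 0 ->
  [/\ (m' + k' <= m + k + 0)%N, (m + k <= m' + k' + 1)%N,
      (k' <= k + 0)%N & (k <= k' + 1)%N].
Proof. by move=> /coefdy_support[-> ->]; clear; split; lia. Qed.

Lemma represents_Dy A C :
  represents Om (frow_map partial_y (HN A C)) (HN A C.+1) (bmx_of (mudy C)).
Proof.
apply: (@represents_bmx_of _ _ _ _ (fun m k => partial_y (hf A C m k))
  (hf A C.+1) _ 0) => //.
  by move=> m' k' m k /coefdy_band[].
move=> m k x y Oxy.
exact: (partial_y_hfun lt_ga_de rho_gt0 rho_q).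
Qed.

Lemma represents_Wy A C :
  represents Om (frow_map partial_y (WN A C.+1)) (WN A C)
    (bmx_of (fun m k m' k' => - mudy C m' k' m k)).
Proof.
apply: (@represents_bmx_of _ _ _ _ (fun m k => partial_y (wf A C.+1 m k))
  (wf A C) _ 1).
- move=> n k x y Oxy; apply: partial_y_eq => // {Oxy}x {}y.
  exact: (W_wfun rho_gt0 rho_q).
- by move=> n k x y; exact: (W_wfun rho_gt0 rho_q).
- by move=> m' k' m k; rewrite oppr_eq0 => /coefdy_band[].
move=> m k x y Oxy.
exact: (partial_y_wfun lt_ga_de rho_gt0 rho_q).
Qed.

Local Notation DxN A C := (Dx al be ga de rho A%:R A%:R C%:R C%:R).
Local Notation DyN A C := (Dy al be ga de rho A%:R A%:R C%:R C%:R).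
Local Notation WxN A C := (Wx al be ga de rho A%:R A%:R C%:R C%:R).
Local Notation WyN A C := (Wy al be ga de rho A%:R A%:R C%:R C%:R).
Local Notation TN A C := (T al be ga de rho A%:R A%:R C%:R C%:R).
Local Notation TWN A C := (TW al be ga de rho A%:R A%:R C%:R C%:R).

Lemma natrS1 n : n.+1%:R - 1 = n%:R :> R.
Proof. by rewrite -natr1 addrK. Qed.

Lemma Dx_spec A C : represents Om (frow_map partial_x (HN A C)) (HN A.+1 C.+1) (DxN A C) /\
  banded_bmx (d - 3) (d + 1) 0 2 (DxN A C).
Proof.
have rep := represents_Dx A C.
have -> : DxN A C = bmx_of (mux A C).
  rewrite /Dx !natr1; exact: matrix_of_represents (@independent_H _ _) rep.
by split=> //; apply: banded_bmx_of => m' k' m k /coefx_band.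
Qed.

Lemma Wx_spec A C : represents Om (frow_map partial_x (WN A.+1 C.+1)) (WN A C) (WxN A.+1 C.+1) /\
  banded_bmx (d + 1) (d - 3) 2 0 (WxN A.+1 C.+1).
Proof.
have rep := represents_Wx A C.
have -> : WxN A.+1 C.+1 = bmx_of (fun m k m' k' => - mux A C m' k' m k).
  rewrite /Wx !natrS1; exact: matrix_of_represents (@independent_W _ _) rep.
split=> //; apply: banded_bmx_of => m' k' m k; rewrite oppr_eq0.
by move=> /coefx_band[].
Qed.

Lemma Dy_spec A C : represents Om (frow_map partial_y (HN A C)) (HN A C.+1) (DyN A C) /\
  banded_bmx 0 1 0 1 (DyN A C).
Proof.
have rep := represents_Dy A C.
have -> : DyN A C = bmx_of (mudy C).
  rewrite /Dy !natr1; exact: matrix_of_represents (@independent_H _ _) rep.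
by split=> //; apply: banded_bmx_of => m' k' m k /coefdy_band.
Qed.

Lemma Wy_spec A C : represents Om (frow_map partial_y (WN A C.+1)) (WN A C) (WyN A C.+1) /\
  banded_bmx 1 0 1 0 (WyN A C.+1).
Proof.
have rep := represents_Wy A C.
have -> : WyN A C.+1 = bmx_of (fun m k m' k' => - mudy C m' k' m k).
  rewrite /Wy !natrS1; exact: matrix_of_represents (@independent_W _ _) rep.
split=> //; apply: banded_bmx_of => m' k' m k; rewrite oppr_eq0.
by move=> /coefdy_band[].
Qed.

Lemma T_spec A C : represents Om (HN A C) (HN A.+1 C) (TN A C) /\
  banded_bmx 0 2 0 0 (TN A C).
Proof.
have rep := represents_T A C.
have -> : TN A C = bmx_of (mut A C).
  rewrite /T !natr1; exact: matrix_of_represents (@independent_H _ _) rep.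
by split=> //; apply: banded_bmx_of => m' k' m k /coeft_band.
Qed.

Lemma TW_spec A C : represents Om (WN A.+1 C) (WN A C) (TWN A.+1 C) /\
  banded_bmx 2 0 0 0 (TWN A.+1 C).
Proof.
have rep := represents_TW A C.
have -> : TWN A.+1 C = bmx_of (fun m k m' k' => mut A C m' k' m k).
  rewrite /TW !natrS1; exact: matrix_of_represents (@independent_W _ _) rep.
by split=> //; apply: banded_bmx_of => m' k' m k /coeft_band[].
Qed.

(** The factors of each product, read from right to left, are the successive
    derivatives and conversions; a conversion has constant coefficients, so the
    next derivative passes through it. *)
Lemma laplacian_W A C :
  represents Om (frow_map laplacian (WN A.+2 C.+2)) (WN A C)
    (WxN A.+1 C.+1 *b WxN A.+2 C.+2
     +b TWN A.+1 C *b WyN A.+1 C.+1 *b TWN A.+2 C.+1 *b WyN A.+2 C.+2).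
Proof.
have px F G M (r : represents Om F G M) dG := (represents_partial_x open_Om r dG).2.
have py F G M (r : represents Om F G M) dG := (represents_partial_y open_Om r dG).2.
apply: represents_add.
  apply: represents_mul (px _ _ _ (Wx_spec A.+1 C.+1).1 _) (Wx_spec A C).1.
  exact: derivable_x_W.
apply: represents_mul (py _ _ _ (Wy_spec A.+2 C.+1).1 _) _; first exact: derivable_y_W.
apply: represents_mul (py _ _ _ (TW_spec A.+1 C.+1).1 _) _; first exact: derivable_y_W.
exact: represents_mul (Wy_spec A.+1 C).1 (TW_spec A C).1.
Qed.

Lemma laplacian_H A C :
  represents Om (frow_map laplacian (HN A C)) (HN A.+2 C.+2)
    (DxN A.+1 C.+1 *b DxN A C
     +b TN A.+1 C.+2 *b DyN A.+1 C.+1 *b TN A C.+1 *b DyN A C).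
Proof.
have px F G M (r : represents Om F G M) dG := (represents_partial_x open_Om r dG).2.
have py F G M (r : represents Om F G M) dG := (represents_partial_y open_Om r dG).2.
apply: represents_add.
  apply: represents_mul (px _ _ _ (Dx_spec A C).1 _) (Dx_spec A.+1 C.+1).1.
  exact: derivable_x_H.
apply: represents_mul (py _ _ _ (Dy_spec A C).1 _) _; first exact: derivable_y_H.
apply: represents_mul (py _ _ _ (T_spec A C.+1).1 _) _; first exact: derivable_y_H.
exact: represents_mul (Dy_spec A.+1 C.+1).1 (T_spec A.+1 C.+2).1.
Qed.

End Representations.

(** * The Laplacian and the biharmonic operator *)

Theorem proposition5p8 (R : realType) (al be ga de : R) (rho : R -> R)
    (eta : bool) (q : {poly R})
    (lt_al_be : al < be) (lt_ga_de : ga < de)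
    (rho_gt0 : forall x, al < x < be -> 0 < rho x)
    (rho_q : rho_case al be ga de rho eta q)
    (deg_q : (2 + eta <= (size q).-1)%N) :
  let H := H al be ga de rho in
  let W := W al be ga de rho in
  let Dx := Dx al be ga de rho in
  let Dy := Dy al be ga de rho in
  let Wx := Wx al be ga de rho in
  let Wy := Wy al be ga de rho in
  let T := T al be ga de rho in
  let TW := TW al be ga de rho in
  let Om := (Omega al be ga de rho)° in
  let d := deg_rho_sqr eta q in
  let Lap_W1111_1111 :=
    Dx 0 0 0 0 *b Wx 1 1 1 1
    +b T 0 0 1 1 *b Dy 0 0 0 0 *b TW 1 1 0 0 *b Wy 1 1 1 1 in
  let Lap_W2222_0000 :=
    Wx 1 1 1 1 *b Wx 2 2 2 2
    +b TW 1 1 0 0 *b Wy 1 1 1 1 *b TW 2 2 1 1 *b Wy 2 2 2 2 in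
  let Lap_0000_2222 :=
    Dx 1 1 1 1 *b Dx 0 0 0 0
    +b T 1 1 2 2 *b Dy 1 1 1 1 *b T 0 0 1 1 *b Dy 0 0 0 0 in
  let Biharm_W2222_2222 := Lap_0000_2222 *b Lap_W2222_0000 in
  [/\ is_matrix_of Om (frow_map laplacian (W 1 1 1 1)) (H 1 1 1 1)
        Lap_W1111_1111,
      block_banded (2 * d - 2) (2 * d - 2) Lap_W1111_1111 &
      banded_blocks 2 2 Lap_W1111_1111] /\
  [/\ is_matrix_of Om (frow_map laplacian (W 2 2 2 2)) (W 0 0 0 0)
        Lap_W2222_0000,
      is_matrix_of Om (frow_map laplacian (H 0 0 0 0)) (H 2 2 2 2)
        Lap_0000_2222,
      is_matrix_of Om (frow_map biharmonic (W 2 2 2 2)) (H 2 2 2 2)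
        Biharm_W2222_2222,
      block_banded (4 * d - 4) (4 * d - 4) Biharm_W2222_2222 &
      banded_blocks 4 4 Biharm_W2222_2222].
Proof.
move=> H W Dx Dy Wx Wy T TW Om d L1 L2 L3 B.
have d3 : (3 <= d)%N := deg_rho_sqr_ge3 deg_q.
have e0 : 0%:R = 0 :> R by rewrite mulr0n.
have e1 : 1%:R = 1 :> R by rewrite mulr1n.
have WH : W 0 0 0 0 = H 0 0 0 0 by have := W_H00 al be ga de rho; rewrite e0.
have iH := independent_H lt_al_be lt_ga_de rho_gt0 rho_q.
have iH00 := iH 0%N 0%N; have iH11 := iH 1%N 1%N; have iH22 := iH 2%N 2%N.
have Dx_spec := Dx_spec lt_al_be lt_ga_de rho_gt0 rho_q deg_q.
have Wx_spec := Wx_spec lt_al_be lt_ga_de rho_gt0 rho_q deg_q.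
have Dy_spec := Dy_spec lt_al_be lt_ga_de rho_gt0 rho_q.
have Wy_spec := Wy_spec lt_al_be lt_ga_de rho_gt0 rho_q.
have T_spec := T_spec lt_al_be lt_ga_de rho_gt0 rho_q.
have TW_spec := TW_spec lt_al_be lt_ga_de rho_gt0 rho_q.
have [Dx0 bDx0] := Dx_spec 0%N 0%N; have [Dx1 bDx1] := Dx_spec 1%N 1%N.
have [Wx1 bWx1] := Wx_spec 0%N 0%N; have [Wx2 bWx2] := Wx_spec 1%N 1%N.
have [Dy0 bDy0] := Dy_spec 0%N 0%N; have [Dy1 bDy1] := Dy_spec 1%N 1%N.
have [Wy1 bWy1] := Wy_spec 1%N 0%N; have [Wy2 bWy2] := Wy_spec 2%N 1%N.
have [T0 bT0] := T_spec 0%N 1%N; have [T1 bT1] := T_spec 1%N 2%N.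
have [TW1 bTW1] := TW_spec 0%N 0%N; have [TW2 bTW2] := TW_spec 1%N 1%N.
have lapW := laplacian_W lt_al_be lt_ga_de rho_gt0 rho_q deg_q 0 0.
have lapH := laplacian_H lt_al_be lt_ga_de rho_gt0 rho_q deg_q 0 0.
have dxH := derivable_x_H rho_gt0 rho_q.
have dyH := @derivable_y_H R al be ga de rho.
have dyW := derivable_y_W rho_gt0 rho_q.
have dxH00 := dxH 0%N 0%N; have dxH11 := dxH 1%N 1%N.
have dyH00 := dyH 0%N 0%N; have dyH01 := dyH 0%N 1%N.
have dyW10 := dyW 1%N 0%N.
rewrite !(e0, e1) in iH00 iH11 iH22 Dx0 bDx0 Dx1 bDx1 Wx1 bWx1 Wx2 bWx2 Dy0 bDy0
  Dy1 bDy1 Wy1 bWy1 Wy2 bWy2 T0 bT0 T1 bT1 TW1 bTW1 TW2 bTW2 lapW lapH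
  dxH00 dxH11 dyH00 dyH01 dyW10.
have repL2 : represents Om (frow_map laplacian (W 2 2 2 2)) (H 0 0 0 0) L2.
  by rewrite -WH.
have oO : open Om := @open_Om R al be ga de rho.
have [dxxH _] := represents_partial_x oO Dx0 dxH11.
have [dyyH _] := represents_partial_y oO Dy0 dyH01.
(* Bandwidths add under products, and the x-terms are the widest: (d - 3) + (d + 1)
   for one Dx and one Wx, and twice d + 1 or d - 3 for two of a kind. *)
have bL1 : banded_bmx (2 * d - 2) (2 * d - 2) 2 2 L1.
  apply: banded_bmx_add.
    by apply: banded_bmx_widen (banded_bmx_mul bDx0 bWx1); clear - d3; lia.
  apply: banded_bmx_widen (banded_bmx_mul (banded_bmx_mul
    (banded_bmx_mul bT0 bDy0) bTW1) bWy1); clear - d3; lia.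
have bL2 : banded_bmx (2 * d + 2) (2 * d - 6) 4 0 L2.
  apply: banded_bmx_add.
    by apply: banded_bmx_widen (banded_bmx_mul bWx1 bWx2); clear - d3; lia.
  apply: banded_bmx_widen (banded_bmx_mul (banded_bmx_mul
    (banded_bmx_mul bTW1 bWy1) bTW2) bWy2); clear - d3; lia.
have bL3 : banded_bmx (2 * d - 6) (2 * d + 2) 0 4 L3.
  apply: banded_bmx_add.
    by apply: banded_bmx_widen (banded_bmx_mul bDx1 bDx0); clear - d3; lia.
  apply: banded_bmx_widen (banded_bmx_mul (banded_bmx_mul
    (banded_bmx_mul bT1 bDy1) bT0) bDy0); clear - d3; lia.
have bB : banded_bmx (4 * d - 4) (4 * d - 4) 4 4 B.
  by apply: banded_bmx_widen (banded_bmx_mul bL3 bL2); clear - d3; lia.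
have repL1 : represents Om (frow_map laplacian (W 1 1 1 1)) (H 1 1 1 1) L1.
  rewrite [Defs.W _ _ _ _ _ 0 0 0 0]WH in Wx1 TW1; apply: represents_add.
    by apply: represents_mul (represents_partial_x oO Wx1 dxH00).2 Dx0.
  apply: represents_mul (represents_partial_y oO Wy1 dyW10).2 _.
  apply: represents_mul (represents_partial_y oO TW1 dyH00).2 _.
  exact: represents_mul Dy0 T0.
have repB : represents Om (frow_map biharmonic (W 2 2 2 2)) (H 2 2 2 2) B.
  apply: represents_mul lapH.
  exact: represents_laplacian oO repL2 dxH00 dxxH dyH00 dyyH.
split; split=> //; try by [case: bL1 | case: bB].
- exact: is_matrix_of_represents iH11 repL1.
- by rewrite WH; exact: is_matrix_of_represents iH00 repL2.
- exact: is_matrix_of_represents iH22 lapH.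
- exact: is_matrix_of_represents iH22 repB.
Qed.
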